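(* Let $(X_n)_{n\in\mathbb{N}}$ be a Wasserstein contractive Markov chain with transition kernel $P$, unique invariant distribution $\pi$ and initial distribution $\nu$ (so $X_1\sim\nu$), with $\nu\ll\pi$ and $\frac{d\nu}{d\pi}\in L^q(\pi)$ for some $q\in(1,\infty)$ with Hoelder conjugate $s\in(1,\infty)$. Assume that $\varepsilon_r<\infty$ for $r=2s$. Assume further that there is a constant $\widehat{C}>0$ such that for every forcing function $g\in\mathscr{L}_0$, with $R_n^*=R_n^*(g)$ as defined in the context, $$\mathbb{E}_\nu\left[|R_n^*|^2\right]\le\widehat{C}\,n\,\|g\|_d^2\qquad\text{for all } n\in\mathbb{N}.$$ Then for any $n\in\mathbb{N}$, $$\sup_{f\in\mathscr{L}_0;\ \|f\|_d\le1}\mathbb{E}_\nu\left[(S_n^*f)^2\right]\le 4n\left(8\left\|\frac{d\nu}{d\pi}\right\|_{L^q(\pi)}(\Lambda\varepsilon_r)^2+\widehat{C}\right).$$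
   Context: $(\mathcal{X},\rho)$ is a non-trivial (more than one point) Polish space with Borel $\sigma$-algebra $\mathcal{B}(\mathcal{X})$, and $d:\mathcal{X}\times\mathcal{X}\to[0,\infty)$ is a metric that is lower semi-continuous with respect to the product topology induced by $\rho$. For probability measures $\mu_1,\mu_2$ on $\mathcal{X}$, $\mathcal{W}(\mu_1,\mu_2)=\inf_{\eta}\int d(x,y)\,\eta(dx,dy)\in[0,\infty]$, the infimum running over all couplings $\eta$ of $\mu_1,\mu_2$. For a Markov kernel $K$ on $\mathcal{X}$, $\tau(K)=\sup_{x\ne y}\mathcal{W}(K(x,\cdot),K(y,\cdot))/d(x,y)$, and $Kf(x)=\int f(x')K(x,dx')$; $K^n$ is the $n$-th iterate, $K^0$ the identity kernel. A Markov chain with transition kernel $P$ is Wasserstein contractive if $\tau(P)<\infty$ and $\tau(P^m)<1$ for some $m\in\mathbb{N}=\{1,2,\dots\}$; in that case $\Lambda:=\sum_{n=0}^\infty\tau(P^n)<\infty$. $\|f\|_d:=\sup_{x\neq y}|f(x)-f(y)|/d(x,y)$; $\mathscr{L}$ is the space of all measurable $f:\mathcal{X}\to\mathbb{R}$ with $\|f\|_d<\infty$, and $\mathscr{L}_0=\{f\in\mathscr{L}:\int f\,d\pi=0\}$. $E_1(x)=\int_{\mathcal{X}}d(x,y)\,\pi(dy)$ and $\varepsilon_p=\left(\int_{\mathcal{X}}E_1(x)^p\,\pi(dx)\right)^{1/p}\in[0,\infty]$. If $\varepsilon_p<\infty$ for some $p\in(1,\infty)$ then $E_1$ is finite, and for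 each $g\in\mathscr{L}_0$ there is exactly one $u\in\mathscr{L}_0$ with $u-Pu=g$ (the solution of Poisson's equation with forcing function $g$); one sets $R_n^*=R_n^*(g)=\max_{1\le k\le n}|u(X_1)-u(X_{k+1})|$. $\mathbb{E}_\nu$ refers to the chain started from $X_1\sim\nu$. $S_n^*f=\max_{1\le k\le n}\left|\sum_{j=1}^kf(X_j)\right|$. *)

(* Defs.v *)
From HB Require Import structures.
From mathcomp Require Import all_boot all_order all_algebra.
From mathcomp Require Import all_classical all_reals all_analysis.
Set Implicit Arguments.
Unset Strict Implicit.
Unset Printing Implicit Defensive.
Import Order.TTheory GRing.Theory Num.Theory.
Import numFieldNormedType.Exports.

Local Open Scope classical_set_scope.
Local Open Scope ring_scope.
Local Open Scope ereal_scope.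

(* Polish spaces with their Borel sigma-algebra.  The distance [mdist] plays the
   role of rho.  Products carry the library's product sigma-algebra, which is
   the Borel sigma-algebra of the product topology since the space is
   separable. *)
HB.mixin Record isPolishBorel (R : realType) d T & Metric R T & Complete T
    & Measurable d T := {
  polish_separable : exists2 D : set T, countable D & dense D ;
  polish_measurableE : d.-measurable = <<s [set U : set T | open U] >> }.

#[short(type="polishType")]
HB.structure Definition Polish (R : realType) d :=
  { T of Metric R T & Complete T & Measurable d T & isPolishBorel R d T }.

Section kernels.
Context d (T : measurableType d) (R : realType).
Implicit Types P Q : R.-pker T ~> T.

Section comp.
Variables P Q : R.-pker T ~> T.

Lemma kcomp_noparam_setT x : kcomp_noparam P Q x [set: T] = 1.
Proof.
rewrite /kcomp_noparam (eq_integral (cst 1)) => [|y _]; last first.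
  by rewrite prob_kernel.
by rewrite integral_cst// mul1e prob_kernel.
Qed.

HB.instance Definition _ := isProbabilityKernel.Build _ _ T T R
  (mkcomp_noparam P Q) kcomp_noparam_setT.

Definition kernel_comp : R.-pker T ~> T := mkcomp_noparam P Q.

End comp.

Definition kernel_id : R.-pker T ~> T := kdirac (@measurable_id _ T setT).

Fixpoint kernel_iter P n : R.-pker T ~> T :=
  if n is m.+1 then kernel_comp P (kernel_iter P m) else kernel_id.

Definition invariant P (mu : probability T R) :=
  forall A, measurable A -> \int[mu]_x P x A = mu A.

Definition unique_invariant P (mu : probability T R) :=
  invariant P mu /\ forall mu' : probability T R, invariant P mu' ->
    forall A, measurable A -> mu' A = mu A.

End kernels.

Section metric.
Context (T : Type) (R : realType).

Record is_metric (rho : T -> T -> R) : Prop := IsMetric {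
  is_metric_ge0 : forall x y, (0 <= rho x y)%R ;
  is_metric_eq0 : forall x y, rho x y = 0%R <-> x = y ;
  is_metric_sym : forall x y, rho x y = rho y x ;
  is_metric_triangle : forall x y z, (rho x z <= rho x y + rho y z)%R }.

Definition lip_norm (rho : T -> T -> R) (f : T -> R) : \bar R :=
  ereal_sup [set (`|f p.1 - f p.2| / rho p.1 p.2)%:E |
             p in [set p : T * T | p.1 <> p.2]].

End metric.

Section wasserstein.
Context d (T : measurableType d) (R : realType) (rho : T -> T -> R).
Implicit Types (P : R.-pker T ~> T) (f g u : T -> R).

Definition coupling (mu1 mu2 : {measure set T -> \bar R}) :
    set (probability (T * T)%type R) :=
  [set eta | (forall A, measurable A -> eta (A `*` [set: T]) = mu1 A) /\
             (forall A, measurable A -> eta ([set: T] `*` A) = mu2 A)].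

Definition wasserstein (mu1 mu2 : {measure set T -> \bar R}) : \bar R :=
  ereal_inf [set \int[eta]_p (rho p.1 p.2)%:E |
             eta in coupling mu1 mu2].

Definition tau P : \bar R :=
  ereal_sup [set wasserstein (P p.1) (P p.2) / (rho p.1 p.2)%:E |
             p in [set p : T * T | p.1 <> p.2]].

Definition wasserstein_contractive P :=
  tau P < +oo /\ exists2 m, (0 < m)%N & tau (kernel_iter P m) < 1.

Definition Lambda P : \bar R := \sum_(0 <= n <oo) tau (kernel_iter P n).

Variable pi : probability T R.

Definition lip_space : set (T -> R) :=
  [set f | measurable_fun [set: T] f /\ lip_norm rho f < +oo].

(* As +oo - +oo = -oo in \bar R, a function whose integral is 0 is
   integrable. *)
Definition lip_space0 : set (T -> R) :=
  [set f | lip_space f /\ \int[pi]_x (f x)%:E = 0].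

Definition E1 (x : T) : \bar R := \int[pi]_y (rho x y)%:E.

Definition eps (p : R) : \bar R := 'N[pi]_p%:E [E1].

(* The equation is stated in \bar R: it forces Pu to be finite. *)
Definition poisson_equation P g u :=
  forall x, (u x)%:E - \int[P x]_y (u y)%:E = (g x)%:E.

(* The solution u in L_0 of Poisson's equation with forcing function g; the zero
   function is a dummy value, used only when there is no solution. *)
Definition poisson_solution P g : T -> R :=
  xget (cst 0%R) [set u | lip_space0 u /\ poisson_equation P g u].

End wasserstein.

Section chains.
Context d (T : measurableType d) d' (Omega : measurableType d') (R : realType).

(* Time starts at 1: X 0 is not part of the chain X 1, X 2, ... *)
Implicit Type X : nat -> {mfun Omega >-> T}.

Definition history X (n : nat) : set (set Omega) :=
  <<s \bigcup_(k in [set k | (1 <= k <= n)%N])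
        preimage_set_system [set: Omega] (X k) measurable >>.

Definition markov_chain (Pr : probability Omega R) X (P : R.-pker T ~> T)
    (nu : probability T R) :=
  (forall A, measurable A -> distribution Pr (X 1%N) A = nu A) /\
  (forall n, (0 < n)%N -> forall B A, history X n B -> measurable A ->
     Pr (B `&` X n.+1 @^-1` A) = \int[Pr]_(w in B) P (X n w) A).

(* S_n^* f and R_n^*(g): in both maxima, 0 is neutral as all the terms are
   nonnegative. *)
Definition S_max X (f : T -> R) (n : nat) (w : Omega) : R :=
  \big[Num.max/0%R]_(1 <= k < n.+1) `|\sum_(1 <= j < k.+1) f (X j w)|%R.

Definition R_max (rho : T -> T -> R) (pi : probability T R)
    (P : R.-pker T ~> T) X (g : T -> R) (n : nat) (w : Omega) : R :=
  let u := poisson_solution rho pi P g in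
  \big[Num.max/0%R]_(1 <= k < n.+1) `|u (X 1%N w) - u (X k.+1 w)|%R.

End chains.

(* Main.v *)
Require Import Defs.
From mathcomp Require Import all_boot all_order all_algebra.
From mathcomp Require Import all_classical all_reals all_analysis.
From mathcomp Require Import measurable_realfun.
From mathcomp Require Import ring lra.
Import Order.TTheory GRing.Theory Num.Theory.
Import numFieldNormedType.Exports.
Set Implicit Arguments.
Unset Strict Implicit.
Unset Printing Implicit Defensive.
Local Open Scope classical_set_scope.
Local Open Scope ring_scope.
Local Open Scope ereal_scope.

(** Let u solve Poisson's equation u - Pu = f.  The sum f(X_1) + ... + f(X_k)
    telescopes to u(X_1) - u(X_{k+1}) + M_k, where M has the increments
    u(X_{j+1}) - Pu(X_j) and is a martingale (poisson_decomposition).  Hence the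
    maximum of the partial sums is at most R + M' with R = R_n and M' the running
    maximum of |M| (S_max_le), and its square is at most 2 R^2 + 2 M'^2.  The
    second moment of R is the hypothesis; it contributes 2 C n.

    Doob's inequality gives E M'^2 <= 4 E M_n^2, and since the increments of M are
    orthogonal, E M_n^2 <= n V as soon as V bounds every E u(X_{j+1})^2
    (running_martingale_moment).  So the whole expectation is at most
    2 C n + 8 n V, which leaves a factor 2 on C and a factor 4 on V.

    To bound V, note that u has mean zero under pi, so |u| <= c E_1 whenever c is
    a Lipschitz constant of u (mean_zero_le); thus the L^s(pi) norm of u^2 is at
    most (c eps_{2s})^2.  The law of X_1 has a density in L^q, so by Hoelder its
    expectations are controlled by L^s(pi) norms, and P does not increase these
    norms by Jensen and invariance; hence the same control holds at each time
    (chain_moment).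

    It remains to solve Poisson's equation with c <= Lambda.  By the easy half of
    Kantorovich duality, P^i multiplies Lipschitz constants by at most tau(P^i)
    (lip_bound_avg, lip_bound_iter_tau).  Factors of this kind multiply when
    operators are composed, so tau(P) < oo and tau(P^m) < 1 bound the Lipschitz
    constant of P^i f by a multiple of tau(P^m)^(i/m), with i/m rounded down
    (lip_bound_iter_blocks).
    Since |P^i f| is then dominated by a summable sequence times E_1, the Neumann
    series of the P^i f converges to a solution (poisson_exists).  For any solution
    u in L_0, u is the sum of P^i f over i < n plus P^n u, and the Lipschitz
    constant of P^n u tends to 0; this gives the constant Lambda
    (poisson_lip_bound).  If Lambda is +oo, any Lipschitz constant of u serves.

    The Markov property is a statement about events.  It is carried over to
    functions, for integrands over the state space and for those over the past,
    by one principle: two functionals that behave like integrals and agree on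
    indicators agree on nonnegative measurable functions (integral_like_eq). *)

(** * Running maxima and summation of real sequences *)

Section real_sequences.
Local Open Scope ring_scope.
Context {R : realType}.
Implicit Types x : nat -> R.

Definition running_max x n := \big[Num.max/0]_(1 <= k < n.+1) `|x k|.

Lemma running_max0 x : running_max x 0 = 0.
Proof. by rewrite /running_max big_geq. Qed.

Lemma running_maxS x n :
  running_max x n.+1 = Num.max (running_max x n) `|x n.+1|.
Proof.
rewrite /running_max.
have -> : index_iota 1 n.+2 = rcons (index_iota 1 n.+1) n.+1.
  by rewrite /index_iota !subSS !subn0 -[n.+1]addn1 iotaD cats1 add1n addn1.
elim: index_iota => [|k r IH]; first by rewrite /= big_cons !big_nil maxC.
by rewrite rcons_cons !big_cons IH maxA.
Qed.

Lemma running_max_ge0 x n : 0 <= running_max x n.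
Proof.
case: n => [|n]; first by rewrite running_max0.
by rewrite running_maxS le_max normr_ge0 orbT.
Qed.

Lemma ler_running_max x n c : 0 <= c ->
  (forall k, (0 < k <= n)%N -> `|x k| <= c) -> running_max x n <= c.
Proof.
move=> c0; elim: n => [|n IH] xc; first by rewrite running_max0.
rewrite running_maxS ge_max IH ?xc ?leqnn//.
by move=> k /andP[k0 kn]; apply: xc; rewrite k0 ltnW.
Qed.

Lemma running_max_ge x n k : (0 < k <= n)%N -> `|x k| <= running_max x n.
Proof.
elim: n => [|n IH]; first by case: k.
rewrite running_maxS le_max => /andP[k0]; rewrite leq_eqVlt.
by case/predU1P => [->|kn]; [rewrite lexx orbT|rewrite IH ?k0].
Qed.

Lemma sqr_running_max_le_sum x n :
  running_max x n ^+ 2 <= \sum_(0 <= k < n) x k.+1 ^+ 2.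
Proof.
elim: n => [|n IH]; first by rewrite running_max0 expr0n big_geq.
rewrite running_maxS big_nat_recr//=; case: (leP (running_max x n)) => _.
  rewrite real_normK ?num_real// lerDr; apply: sumr_ge0 => k _.
  exact: sqr_ge0.
by rewrite ler_wpDr ?sqr_ge0.
Qed.

(** Doob's L^2 inequality before taking expectations.  When x is a martingale the
    sum has mean zero, since the coefficient of x_{i+1} - x_i depends on the past
    only.  The proof is a discrete integration by parts of b d|x|, with b the running
    maximum: b increases only when |x| = b, so the sum is at most
    b_n |x_n| - b_n^2 / 2. *)
Lemma pathwise_doob x n : x 0%N = 0 ->
  running_max x n ^+ 2 <= 4 * x n ^+ 2
    - 4 * \sum_(0 <= i < n) running_max x i * Num.sg (x i) * (x i.+1 - x i).
Proof.
move=> x0; set S := \sum_(0 <= i < n) _.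
suff: S <= running_max x n * `|x n| - running_max x n ^+ 2 / 2.
  (* b |x| <= b^2 / 4 + x^2 absorbs half of b^2 / 2 *)
  have := sqr_ge0 (running_max x n - 2 * `|x n|).
  rewrite -(real_normK (num_real (x n))).
  move: S `|x n| (running_max x n) => S y b; lra.
rewrite {}/S; elim: n => [|n IH].
  by rewrite running_max0 big_geq// mul0r expr0n mul0r subr0.
rewrite big_nat_recr//=; move: IH; set S := \sum_(0 <= i < n) _ => IH.
have b0 := running_max_ge0 x n.
have sgx : Num.sg (x n) * (x n.+1 - x n) <= `|x n.+1| - `|x n|.
  rewrite mulrBr mulrC -normrEsg lerD2r.
  rewrite -[leLHS]mulrC (le_trans (ler_norm _))// normrM.
  by rewrite ler_piMl// normr_sg; case: (_ != _).
have : S + running_max x n * Num.sg (x n) * (x n.+1 - x n) <=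
    running_max x n * `|x n.+1| - running_max x n ^+ 2 / 2.
  by have := ler_wpM2l b0 sgx; lra.
move/le_trans; apply; rewrite running_maxS.
move: `|x n.+1| (running_max x n) => y b; rewrite maxEle.
by case: ifPn => // _; have := sqr_ge0 (y - b); nra.
Qed.

Lemma measurable_running_max d (S : measurableType d) (y : nat -> S -> R) n :
  (forall k, (k <= n)%N -> measurable_fun setT (y k)) ->
  measurable_fun setT (fun w => running_max (y ^~ w) n).
Proof.
elim: n => [|n IH] my.
  by under eq_fun do rewrite running_max0; exact: measurable_cst.
under eq_fun do rewrite running_maxS.
apply: measurable_maxr; first by apply: IH => k kn; exact/my/leqW.
by apply: measurableT_comp => //; exact: my.
Qed.

(** Bound on the i-th power of an operator whose m-th power has norm at most k
    and whose first power has norm at most t. *)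
Definition geometric_by_blocks (k t : R) m i := k ^+ (i %/ m) * t ^+ (i %% m).

Lemma geometric_by_blocks_ge0 k t m i :
  0 <= k -> 0 <= t -> 0 <= geometric_by_blocks k t m i.
Proof. by move=> k0 t0; rewrite mulr_ge0// exprn_ge0. Qed.

(** Shifting by a block multiplies the terms by k, so a partial sum S satisfies
    S <= S_m + k S and is bounded by S_m / (1 - k). *)
Lemma cvg_series_geometric_by_blocks k t m : (0 < m)%N ->
  0 <= k -> k < 1 -> 0 <= t ->
  cvgn (series (geometric_by_blocks k t m)).
Proof.
move=> m0 k0 k1 t0; set c := geometric_by_blocks _ _ _.
have c0 i : 0 <= c i by exact: geometric_by_blocks_ge0.
have cm i : c (m + i)%N = k * c i.
  by rewrite /c/geometric_by_blocks modnDl divnDl// divnn m0 add1n exprS mulrA.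
pose B := series c m / (1 - k).
apply: nondecreasing_is_cvgn.
  exact: nondecreasing_series.
exists B => _ [n _ <-].
rewrite /B ler_pdivlMr ?subr_gt0// mulrBr mulr1 lerBlDr.
apply: (@le_trans _ _ (series c (m + n)%N)).
  by apply: (nondecreasing_series (P := xpredT));
    [move=> *; exact: c0|rewrite leq_addl].
rewrite /series/= (@big_cat_nat _ _ _ m)//= ?leq_addr// lerD2l.
rewrite -{1}[m]add0n big_addn addKn.
under eq_bigr do rewrite addnC cm.
by rewrite -mulr_sumr mulrC.
Qed.

End real_sequences.

(** * Lower semicontinuous functions on the square of a Polish space *)

Section polish_product.
Context (R : realType) dT (T : polishType R dT).

Lemma polish_open_measurable (U : set T) : open U -> measurable U.
Proof. by move=> oU; rewrite polish_measurableE; exact: sub_sigma_algebra. Qed.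

(** By separability an open set of the square is a countable union of rectangles
    of open sets, which lie in the product sigma-algebra. *)
Lemma polish_prod_open_measurable (U : set (T * T)%type) :
  open U -> measurable U.
Proof.
move=> oU; have [D /pcard_surjP[e eD] denseD] := @polish_separable R dT T.
pose r n : R := (n.+1%:R^-1)%R.
have r0 n : (0 < r n)%R by rewrite invr_gt0.
(* balls are replaced by their interiors, as only these are visibly open *)
pose V i n : set T := (ball (e i) (r n *+ 2)%R)°.
pose F (k : nat * nat * nat) : set (T * T) :=
  if `[< V k.1.1 k.2 `*` V k.1.2 k.2 `<=` U >]
  then V k.1.1 k.2 `*` V k.1.2 k.2 else set0.
have Vx x n : exists i, V i n x.
  have [] := denseD (ball x (r n))°.
  - by exists x; exact: nbhsx_ballx.
  - exact: open_interior.
  move=> a [xa /eD[i _ eia]]; exists i; rewrite /V eia.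
  apply/nbhs_ballP; exists (r n) => //= y xy.
  rewrite mulr2n; apply: ball_triangle xy.
  by apply: ball_sym; exact: interior_subset xa.
have VB x i n : V i n x -> V i n `<=` ball x (r n *+ 4)%R.
  move=> /interior_subset ix y /interior_subset iy.
  by rewrite (mulrnDr _ 2 2); apply: ball_triangle iy; exact: ball_sym.
suff -> : U = \bigcup_k F k.
  apply: countable_bigcupT_measurable => [|[[i j] n]]; first exact: countableP.
  rewrite /F/=; case: asboolP => // _.
  by apply: measurableX; apply: polish_open_measurable; exact: open_interior.
apply/seteqP; split=> [[x y] Uxy|p [k _]]; last first.
  by rewrite /F; case: asboolP => //; exact.
have [[A B] /= [/nbhs_ballP[a /= a0 aA] /nbhs_ballP[b /= b0 bB]] ABU] :
  nbhs (x, y) U by exact: open_nbhs_nbhs.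
have [n rn] : exists n, (r n *+ 4 <= Num.min a b)%R.
  have m0 : (0 < Num.min a b / 4)%R by rewrite divr_gt0// lt_min a0.
  near \oo => n; exists n; rewrite -mulr_natr -ler_pdivlMr//.
  by apply: ltW; near: n; exact: near_infty_natSinv_lt (PosNum m0).
have [i Vi] := Vx x n; have [j Vj] := Vx y n.
exists (i, j, n) => //; rewrite /F/=; case: asboolP => // -[] -[x' y'] /= [x'V y'V].
apply: ABU; split => /=.
  apply: aA; apply: le_ball (VB _ _ _ Vi _ x'V).
  by rewrite (le_trans rn)// ge_min lexx.
apply: bB; apply: le_ball (VB _ _ _ Vj _ y'V).
by rewrite (le_trans rn)// ge_min lexx orbT.
Unshelve. all: by end_near. Qed.

Lemma polish_lower_semicontinuous_measurable (f : T * T -> \bar R) :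
  lower_semicontinuous f -> measurable_fun setT f.
Proof.
move=> /lower_semicontinuousP lscf.
apply: (measurability _ (ErealGenOInfty.measurableE R)) => _ /= [_ [a ->]] <-.
rewrite setTI preimage_itvoy; exact: polish_prod_open_measurable.
Qed.

End polish_product.

(** * Functionals that behave like integrals *)

Section integral_like.
Context d (T : measurableType d) (R : realType).
Implicit Types (I J : (T -> \bar R) -> \bar R) (f g : T -> \bar R).

(** The properties of f |-> int f dm on nonnegative measurable functions.  With
    functionals in place of measures, iterated integrals and integrals of f
    against a weight are treated alike, through closure under mixtures
    (integral_like_mixture). *)
Record integral_like I : Prop := IntegralLike {
  integral_likeD : forall f g,
    measurable_fun setT f -> (forall x, 0 <= f x) ->
    measurable_fun setT g -> (forall x, 0 <= g x) ->
    I (fun x => f x + g x) = I f + I g ;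
  integral_likeZ : forall k f, (0 <= k)%R ->
    measurable_fun setT f -> (forall x, 0 <= f x) ->
    I (fun x => k%:E * f x) = k%:E * I f ;
  integral_like_le : forall f g,
    measurable_fun setT f -> (forall x, 0 <= f x) ->
    measurable_fun setT g -> (forall x, f x <= g x) -> I f <= I g ;
  integral_like_cvg : forall (f_ : (T -> \bar R)^nat) f,
    (forall n, measurable_fun setT (f_ n)) -> (forall n x, 0 <= f_ n x) ->
    (forall x, {homo f_ ^~ x : m n / (m <= n)%N >-> m <= n}) ->
    (forall x, f_ n x @[n --> \oo] --> f x) ->
    I (f_ n) @[n --> \oo] --> I f }.

Import HBNNSimple.

(** Indicators determine the values on simple functions, and monotone limits of
    these give the rest. *)
Lemma integral_like_eq I J : integral_like I -> integral_like J ->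
  (forall A, measurable A ->
    I (fun x => (\1_A x)%:E) = J (fun x => (\1_A x)%:E)) ->
  forall f, measurable_fun setT f -> (forall x, 0 <= f x) -> I f = J f.
Proof.
move=> hI hJ IJ1 f mf f0.
have mindic (A : set T) : measurable A ->
  measurable_fun setT (fun x => (\1_A x)%:E : \bar R).
  by move=> mA; exact/measurable_EFinP.
have indic0 (A : set T) x : 0 <= (\1_A x)%:E :> \bar R by rewrite lee_fin.
have IJsum (A : R -> set T) (s : seq R) : (forall r, measurable (A r)) ->
    (* absolute values keep the coefficients nonnegative for arbitrary s *)
    I (fun x => \sum_(r <- s) `|r|%:E * (\1_(A r) x)%:E) =
    J (fun x => \sum_(r <- s) `|r|%:E * (\1_(A r) x)%:E).
{ move=> mA; elim: s => [|r s IH].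
    rewrite (_ : (fun _ => _) = (fun x => 0%:E * (\1_setT x)%:E)).
      by rewrite !integral_likeZ//; [rewrite !mul0e|exact: mindic..].
    by apply/funext => x; rewrite big_nil mul0e.
  under eq_fun do rewrite big_cons.
  rewrite !integral_likeD ?IH ?integral_likeZ ?IJ1//.
  all: try exact: mindic.
  all: try by [apply: measurable_funeM; exact: mindic].
  all: try by [move=> x; rewrite mule_ge0// lee_fin].
  all: try by [apply: emeasurable_sum => i; apply: measurable_funeM; exact: mindic].
  all: by move=> x; apply: sume_ge0 => i _; rewrite mule_ge0// lee_fin. }
have IJsfun (h : {nnsfun T >-> R}) : I (EFin \o h) = J (EFin \o h).
  suff -> : EFin \o h = fun x => \sum_(r <- finmap.enum_fset (fset_set (range h)))
      `|r|%:E * (\1_(h @^-1` [set r]) x)%:E by exact: IJsum.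
  apply/funext => x /=; rewrite fimfunE fsbig_finite//= -sumEFin big_seq.
  rewrite [RHS]big_seq; apply: eq_bigr => r; rewrite in_fset_set// in_setE => -[y _ <-].
  by rewrite ger0_norm.
pose h := nnsfun_approx measurableT mf.
have h_props (K : (T -> \bar R) -> \bar R) : integral_like K ->
  K (EFin \o h n) @[n --> \oo] --> K f.
  move=> hK; apply: (integral_like_cvg hK) => //=.
  - by move=> n; exact/measurable_EFinP.
  - by move=> n x; rewrite lee_fin.
  - by move=> x m n mn; rewrite lee_fin; exact/lefP/nd_nnsfun_approx.
  - by move=> x; exact: cvg_nnsfun_approx.
apply: (cvg_unique (@ereal_hausdorff R) (h_props I hI)).
rewrite (_ : (fun n => I _) = (fun n => J (EFin \o h n))); first exact: h_props.
by apply/funext => n; exact: IJsfun.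
Qed.

End integral_like.

Section integral_like_instances.
Context d (T : measurableType d) (R : realType).
Implicit Types f g : T -> \bar R.

Lemma integral_like_integral (m : {measure set T -> \bar R}) :
  integral_like (fun f => \int[m]_x f x).
Proof.
split=> [f g mf f0 mg g0|k f k0 mf f0|f g mf f0 mg fg|f_ f mf f0 ndf cf].
- exact: ge0_integralD.
- by apply: ge0_integralZl.
- exact: ge0_le_integral.
- have -> : f = fun x => limn (f_ ^~ x).
    by apply/funext => x; apply/esym/cvg_lim => //; exact: cf.
  by apply: cvg_monotone_convergence.
Qed.

Lemma integral_like_eval (x : T) (c : R) : (0 <= c)%R ->
  integral_like (fun f => f x * c%:E).
Proof.
move=> c0; split=> [f g _ f0 _ g0|k f k0 _ f0|f g _ _ _ fg|f_ f _ _ _ cf].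
- by rewrite ge0_muleDl.
- by rewrite muleA.
- by rewrite lee_wpmul2r// lee_fin.
- exact: cvgeZr.
Qed.

Lemma integral_like_mixture d' (S : measurableType d')
    (m : {measure set S -> \bar R}) (D : set S)
    (L : S -> (T -> \bar R) -> \bar R) :
  measurable D -> (forall w, integral_like (L w)) ->
  (forall w f, (forall x, 0 <= f x) -> 0 <= L w f) ->
  (forall f, measurable_fun setT f -> (forall x, 0 <= f x) ->
    measurable_fun setT (L ^~ f)) ->
  integral_like (fun f => \int[m]_(w in D) L w f).
Proof.
move=> mD hL L0 mL.
have mLD f : measurable_fun setT f -> (forall x, 0 <= f x) ->
    measurable_fun D (L ^~ f).
  by move=> mf f0; apply: measurable_funTS; exact: mL.
split=> [f g mf f0 mg g0|k f k0 mf f0|f g mf f0 mg fg|f_ f mf f0 ndf cf].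
- rewrite -ge0_integralD//; last 4 first.
  + by move=> w _; exact: L0.
  + exact: mLD.
  + by move=> w _; exact: L0.
  + exact: mLD.
  by apply: eq_integral => w _; rewrite (integral_likeD (hL w)).
- rewrite -ge0_integralZl//; last 2 first.
  + exact: mLD.
  + by move=> w _; exact: L0.
  by apply: eq_integral => w _; rewrite (integral_likeZ (hL w)).
- have g0 x : 0 <= g x by exact: le_trans (fg x).
  apply: ge0_le_integral => //.
  + by move=> w _; exact: L0.
  + exact: mLD.
  + exact: mLD.
  + by move=> w _; exact: integral_like_le (hL w) _ _ _ _ _ _.
- rewrite (_ : \int[m]_(w in D) L w f =
      \int[m]_(w in D) limn (fun n => L w (f_ n))).
    apply: cvg_monotone_convergence => //.
    + by move=> n; apply: mLD.
    + by move=> n w _; exact: L0.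
    + by move=> w _ i j ij; apply: (integral_like_le (hL w)) => // x; exact: ndf.
  apply: eq_integral => w _; apply/esym/cvg_lim => //.
  exact: (integral_like_cvg (hL w)).
Qed.

End integral_like_instances.

Section kernel_mixtures.
Context d (T : measurableType d) d' (S : measurableType d') (R : realType).
Context (m : {measure set S -> \bar R}) (D : set S) (mD : measurable D).

Lemma integral_like_kernel_mixture d1 (U : measurableType d1)
    (K : R.-ker T ~> U) (X : S -> T) : measurable_fun setT X ->
  integral_like (fun f => \int[m]_(w in D) \int[K (X w)]_y f y).
Proof.
move=> mX; apply: integral_like_mixture => //.
- by move=> w; exact: integral_like_integral.
- by move=> w f f0; exact: integral_ge0.
- move=> f mf f0.
  apply: (@measurableT_comp _ _ _ _ _ _ (fun x => \int[K x]_y f y)) => //.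
  apply: measurable_fun_integral_kernel => // A mA; exact: measurable_kernel.
Qed.

Lemma integral_kernel_mixture d1 (U : measurableType d1) (K : R.-ker T ~> U)
    (X : S -> T) (Q : {measure set U -> \bar R}) (f : U -> \bar R) :
  measurable_fun setT X ->
  (forall A, measurable A -> Q A = \int[m]_(w in D) K (X w) A) ->
  measurable_fun setT f -> (forall x, 0 <= f x) ->
  \int[Q]_y f y = \int[m]_(w in D) \int[K (X w)]_y f y.
Proof.
move=> mX QE mf f0.
apply: (integral_like_eq (integral_like_integral Q)
  (integral_like_kernel_mixture K mX) _ mf f0).
move=> A mA; rewrite integral_indic// setIT QE//; apply: eq_integral => w _.
by rewrite integral_indic// setIT.
Qed.

End kernel_mixtures.

Section averages.
Context d (T : measurableType d) (R : realType).
Implicit Types (K : R.-pker T ~> T) (f g : T -> R).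

(** The function Kf of the theory of Markov kernels, real-valued: its values are
    meaningful at the points x where f is K(x, .)-integrable (EFin_avg). *)
Definition avg K f (x : T) : R := Rintegral (K x) setT f.

Lemma EFin_avg K f x : (K x).-integrable setT (EFin \o f) ->
  (avg K f x)%:E = \int[K x]_y (f y)%:E.
Proof. by move=> fi; rewrite /avg /Rintegral fineK// integrable_fin_num. Qed.

Lemma avg_ge0 K f x : (forall y, (0 <= f y)%R) -> (0 <= avg K f x)%R.
Proof. by move=> f0; exact: Rintegral_ge0. Qed.

Lemma avgB K f g x : (K x).-integrable setT (EFin \o f) ->
  (K x).-integrable setT (EFin \o g) ->
  avg K (fun y => f y - g y)%R x = (avg K f x - avg K g x)%R.
Proof. exact: RintegralB. Qed.

Lemma measurable_avg K f : measurable_fun setT f ->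
  (forall x, (K x).-integrable setT (EFin \o f)) -> measurable_fun setT (avg K f).
Proof.
move=> mf fi.
have mker g : (forall y, (0 <= g y)%R) -> measurable_fun setT g ->
    measurable_fun setT (avg K g).
  move=> g0 mg; apply: (measurableT_comp (@fine_measurable _ setT _)) => //.
  apply: measurable_fun_integral_kernel => //.
  + by move=> A mA; exact: measurable_kernel.
  + exact/measurable_EFinP.
rewrite (_ : avg K f = fun x => (avg K f^\+ x - avg K f^\- x)%R).
  apply: measurable_funB; apply: mker.
  + exact: funrpos_ge0.
  + exact: measurable_funrpos.
  + exact: funrneg_ge0.
  + exact: measurable_funrneg.
apply/funext => x; rewrite -avgB; last 2 first.
- exact: integrable_funrpos.
- exact: integrable_funrneg.
by congr avg; rewrite -{1}(funrposBneg f).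
Qed.

End averages.

Section funr_parts.
Context (U : Type) (R : realType).
Implicit Types f : U -> R.

Lemma funrpos_le_norm f x : (f^\+ x <= `|f x|)%R.
Proof. by rewrite /funrpos ge_max ler_norm normr_ge0. Qed.

Lemma funrneg_le_norm f x : (f^\- x <= `|f x|)%R.
Proof. by rewrite /funrneg ge_max -normrN ler_norm normr_ge0. Qed.

End funr_parts.

(** * The Markov property for functions *)

(** X and X' stand for two consecutive states and G generates the past. *)
Section one_step.
Context d (T : measurableType d) d' (Omega : measurableType d') (R : realType).
Context (Pr : probability Omega R) (K : R.-pker T ~> T) (X X' : Omega -> T).
Context (G : set (set Omega)).
Hypothesis mX : measurable_fun setT X.
Hypothesis mX' : measurable_fun setT X'.
Hypothesis Gm : <<s G >> `<=` measurable.
Hypothesis X'E : forall B A, <<s G >> B -> measurable A ->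
  Pr (B `&` X' @^-1` A) = \int[Pr]_(w in B) K (X w) A.
Implicit Types (H : g_sigma_algebraType G -> R) (f : T -> R).

Lemma one_step_measurable H : measurable_fun setT H ->
  measurable_fun (setT : set Omega) H.
Proof.
move=> mH _ A mA; rewrite setTI; apply: Gm.
by have := mH measurableT A mA; rewrite setTI.
Qed.

Lemma one_step_ge0_event B (f : T -> \bar R) : <<s G >> B ->
  measurable_fun setT f -> (forall x, 0 <= f x) ->
  \int[Pr]_(w in B) f (X' w) = \int[Pr]_(w in B) \int[K (X w)]_y f y.
Proof.
move=> GB mf f0; have mB := Gm GB.
pose L w (g : T -> \bar R) := g (X' w) * 1%:E.
rewrite (_ : \int[Pr]_(w in B) f (X' w) = \int[Pr]_(w in B) L w f); last first.
  by apply: eq_integral => w _; rewrite /L mule1.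
apply: (@integral_like_eq _ T R (fun g => \int[Pr]_(w in B) L w g)
  (fun g => \int[Pr]_(w in B) \int[K (X w)]_y g y)) => //.
- apply: integral_like_mixture => //.
  + by move=> w; exact: integral_like_eval.
  + by move=> w g g0; rewrite mule_ge0.
  + move=> g mg g0; under eq_fun do rewrite /L mule1.
    exact: measurableT_comp.
- exact: integral_like_kernel_mixture.
- move=> A mA.
  under [RHS]eq_integral do rewrite integral_indic// setIT.
  rewrite -X'E// -[in RHS](setIC) -integral_indic//.
    by apply: eq_integral => w _; rewrite /L mule1.
  by rewrite -[X in measurable X]setTI; exact: mX'.
Qed.

(** The event version one_step_ge0_event is the case of indicators; both sides
    are integral-like in H on the sub-sigma-algebra. *)
Lemma one_step_ge0 (H : g_sigma_algebraType G -> \bar R) f :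
  measurable_fun setT H -> (forall w, 0 <= H w) ->
  measurable_fun setT f -> (forall x, (0 <= f x)%R) ->
  (forall x, (K x).-integrable setT (EFin \o f)) ->
  \int[Pr]_w (H w * (f (X' w))%:E) = \int[Pr]_w (H w * (avg K f (X w))%:E).
Proof.
move=> mH H0 mf f0 fi.
have il (c : Omega -> R) : measurable_fun setT c -> (forall w, (0 <= c w)%R) ->
    @integral_like _ (g_sigma_algebraType G) R
      (fun h => \int[Pr]_(w in setT) (h w * (c w)%:E)).
  move=> mc c0; apply: integral_like_mixture => //.
  - by move=> w; exact: integral_like_eval.
  - by move=> w h h0; rewrite mule_ge0// lee_fin.
  - move=> h mh h0; apply: emeasurable_funM; last exact/measurable_EFinP.
    move=> _ A mA; rewrite setTI; apply: Gm.
    by have := mh measurableT A mA; rewrite setTI.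
have mavg : measurable_fun setT (avg K f) by exact: measurable_avg.
apply: (integral_like_eq (il (f \o X') _ _) (il (avg K f \o X) _ _)) => //.
- exact: measurableT_comp.
- by move=> w; exact: f0.
- exact: measurableT_comp.
- by move=> w; exact: avg_ge0.
move=> B GB; have mB := Gm GB.
have indicE (c : Omega -> R) : \int[Pr]_w ((\1_B w)%:E * (c w)%:E) =
    \int[Pr]_(w in B) (c w)%:E.
  rewrite [RHS]integral_mkcond; apply: eq_integral => w _.
  by rewrite patchE indicE; case: ifPn => _; rewrite ?mul1e ?mul0e.
rewrite !indicE /= (@one_step_ge0_event B (EFin \o f))//.
- by apply: eq_integral => w _; rewrite EFin_avg.
- exact/measurable_EFinP.
Qed.

Let one_step_ge0l H f :
  measurable_fun setT H -> (forall w, (0 <= H w)%R) -> measurable_fun setT f ->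
  (forall x, (K x).-integrable setT (EFin \o f)) ->
  Pr.-integrable setT (fun w => (H w * f (X' w))%:E) ->
  Pr.-integrable setT (fun w => (H w * avg K f (X w))%:E) /\
  \int[Pr]_w (H w * f (X' w))%:E = \int[Pr]_w (H w * avg K f (X w))%:E.
Proof.
move=> mH H0 mf fi Hfi; have mHO := one_step_measurable mH.
have part (g : T -> R) : measurable_fun setT g -> (forall x, (0 <= g x)%R) ->
    (forall x, (g x <= `|f x|)%R) ->
    [/\ (forall x, (K x).-integrable setT (EFin \o g)),
        Pr.-integrable setT (fun w => (H w * g (X' w))%:E),
        Pr.-integrable setT (fun w => (H w * avg K g (X w))%:E) &
    \int[Pr]_w (H w * g (X' w))%:E = \int[Pr]_w (H w * avg K g (X w))%:E].
  move=> mg g0 gf.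
  have gi x : (K x).-integrable setT (EFin \o g).
    apply: le_integrable (fi x) => //; first exact/measurable_EFinP.
    by move=> y _ /=; rewrite lee_fin ger0_norm.
  have Hgi : Pr.-integrable setT (fun w => (H w * g (X' w))%:E).
    apply: le_integrable Hfi => //.
      by apply/measurable_EFinP/measurable_funM => //; exact: measurableT_comp.
    by move=> w _ /=; rewrite lee_fin !normrM (ger0_norm (g0 _)) ler_wpM2l.
  have E : \int[Pr]_w (H w * g (X' w))%:E = \int[Pr]_w (H w * avg K g (X w))%:E.
    apply: (one_step_ge0 (H := EFin \o H)) => //; exact/measurable_EFinP.
  split=> //; apply/integrableP; split.
    apply/measurable_EFinP/measurable_funM => //; apply: measurableT_comp => //.
    exact: measurable_avg.
  under eq_integral do rewrite gee0_abs ?lee_fin ?mulr_ge0 ?avg_ge0//.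
  by rewrite -E integrable_lty.
have [fpi Hfpi Hafpi Ep] := part f^\+%R (measurable_funrpos mf) (funrpos_ge0 f)
  (funrpos_le_norm f).
have [fni Hfni Hafni En] := part f^\-%R (measurable_funrneg mf) (funrneg_ge0 f)
  (funrneg_le_norm f).
have e1 : (fun w => (H w * f (X' w))%:E) =
    (fun w => (H w * f^\+%R (X' w))%:E - (H w * f^\-%R (X' w))%:E).
  apply/funext => w; rewrite -EFinB -mulrBr; congr (_ * _)%:E.
  by rewrite -{1}(funrposBneg f).
have e2 : (fun w => (H w * avg K f (X w))%:E) =
    (fun w => (H w * avg K f^\+%R (X w))%:E - (H w * avg K f^\-%R (X w))%:E).
  apply/funext => w; rewrite -EFinB -mulrBr -avgB//; congr (_ * _)%:E.
  by congr avg; rewrite -{1}(funrposBneg f).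
rewrite e1 e2; split; first exact: integrableB.
by rewrite !integralB_EFin// Ep En.
Qed.

(** Integrability is assumed for the left-hand side only: it passes to the
    right-hand side by applying one_step_ge0 to positive and negative parts. *)
Lemma one_step H f : measurable_fun setT H -> measurable_fun setT f ->
  (forall x, (K x).-integrable setT (EFin \o f)) ->
  Pr.-integrable setT (fun w => (H w * f (X' w))%:E) ->
  Pr.-integrable setT (fun w => (H w * avg K f (X w))%:E) /\
  \int[Pr]_w (H w * f (X' w))%:E = \int[Pr]_w (H w * avg K f (X w))%:E.
Proof.
move=> mH mf fi Hfi; have mHO := one_step_measurable mH.
have part (h : g_sigma_algebraType G -> R) :
    measurable_fun setT h -> (forall w, (0 <= h w)%R) ->
    (forall w, (h w <= `|H w|)%R) ->
    Pr.-integrable setT (fun w => (h w * f (X' w))%:E).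
  move=> mh h0 hH; apply: le_integrable Hfi => //.
    apply/measurable_EFinP/measurable_funM; last exact: measurableT_comp.
    exact: one_step_measurable.
  by move=> w _ /=; rewrite lee_fin !normrM (ger0_norm (h0 _)) ler_wpM2r.
have ip := part H^\+%R (measurable_funrpos mH) (funrpos_ge0 H) (funrpos_le_norm H).
have [ip' Ep] := one_step_ge0l (measurable_funrpos mH) (funrpos_ge0 H) mf fi ip.
have in_ := part H^\-%R (measurable_funrneg mH) (funrneg_ge0 H) (funrneg_le_norm H).
have [in' En] := one_step_ge0l (measurable_funrneg mH) (funrneg_ge0 H) mf fi in_.
have e (c : Omega -> R) : (fun w => (H w * c w)%:E) =
    (fun w => (H^\+%R w * c w)%:E - (H^\-%R w * c w)%:E).
  apply/funext => w; rewrite -EFinB -mulrBl; congr (_ * _)%:E.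
  by rewrite -{1}(funrposBneg H).
rewrite (e (f \o X')) (e (avg K f \o X)); split; first exact: integrableB.
by rewrite !integralB_EFin// Ep En.
Qed.

End one_step.

(** * Transfer of integrals along laws and mixtures *)

Section image_law.
Context d (T : measurableType d) d' (S : measurableType d') (R : realType).
Context (m : {measure set S -> \bar R}) (Q : {measure set T -> \bar R}).
Context (X : S -> T).
Hypothesis mX : measurable_fun setT X.
Hypothesis QE : forall A, measurable A -> Q A = m (X @^-1` A).

Lemma ge0_integral_law (f : T -> \bar R) : measurable_fun setT f ->
  (forall x, 0 <= f x) -> \int[Q]_x f x = \int[m]_w f (X w).
Proof.
move=> mf f0; have := @ge0_integral_pushforward _ _ _ _ _ _ mX m setT f.
rewrite preimage_setT => <-//.
by apply: eq_measure_integral => A mA _; exact: QE.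
Qed.

Lemma integrable_law (f : T -> \bar R) : Q.-integrable setT f ->
  m.-integrable setT (f \o X).
Proof.
move=> /integrableP[mf foo]; apply/integrableP; split.
  exact: measurableT_comp.
rewrite (_ : \int[m]_x _ = \int[Q]_x `|f x|)//.
rewrite (@ge0_integral_law (abse \o f))//; last by move=> x; exact: abse_ge0.
by apply: measurableT_comp mf; exact: abse_measurable.
Qed.

Lemma integral_law (f : T -> \bar R) : Q.-integrable setT f ->
  \int[Q]_x f x = \int[m]_w f (X w).
Proof.
move=> fi; have mf := measurable_int _ fi.
have := @integral_pushforward _ _ _ _ _ _ mX m setT f mf.
rewrite preimage_setT => <-//; last exact: integrable_law.
by apply: eq_measure_integral => A mA _; exact: QE.
Qed.

End image_law.

Section signed_mixture.
Context d (T : measurableType d) d' (S : measurableType d') (R : realType).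
Context (m : {measure set S -> \bar R}) (K : R.-pker T ~> T) (X : S -> T).
Context (Q : {measure set T -> \bar R}).
Hypothesis mX : measurable_fun setT X.
Hypothesis QE : forall A, measurable A -> Q A = \int[m]_w K (X w) A.

Lemma integral_kernel_mixture_signed (f : T -> R) :
  (forall x, (K x).-integrable setT (EFin \o f)) ->
  Q.-integrable setT (EFin \o f) ->
  m.-integrable setT (EFin \o (avg K f \o X)) /\
  \int[Q]_x (f x)%:E = \int[m]_w (avg K f (X w))%:E.
Proof.
move=> fi Qfi; have /measurable_EFinP mf := measurable_int _ Qfi.
have part (g : T -> R) : (forall x, (0 <= g x)%R) ->
    (forall x, (K x).-integrable setT (EFin \o g)) ->
    Q.-integrable setT (EFin \o g) ->
    m.-integrable setT (EFin \o (avg K g \o X)) /\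
    \int[Q]_x (g x)%:E = \int[m]_w (avg K g (X w))%:E.
  move=> g0 gi Qgi; have /measurable_EFinP mg := measurable_int _ Qgi.
  have E : \int[Q]_x (g x)%:E = \int[m]_w (avg K g (X w))%:E.
    rewrite (integral_kernel_mixture measurableT mX QE)//.
    - by apply: eq_integral => w _; rewrite EFin_avg.
    - exact/measurable_EFinP.
  split=> //; apply/integrableP; split.
    apply/measurable_EFinP; apply: measurableT_comp => //.
    exact: measurable_avg.
  under eq_integral do rewrite /= ger0_norm ?avg_ge0//.
  by rewrite -E integrable_lty.
have fpi x := integrable_funrpos measurableT (fi x).
have fni x := integrable_funrneg measurableT (fi x).
have Qfpi := integrable_funrpos measurableT Qfi.
have Qfni := integrable_funrneg measurableT Qfi.
have [mp Ep] := part _ (funrpos_ge0 f) fpi Qfpi.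
have [mn En] := part _ (funrneg_ge0 f) fni Qfni.
have E1 : (fun x => (f x)%:E) = (fun x => (f^\+%R x)%:E - (f^\-%R x)%:E).
  by apply/funext => x; rewrite -EFinB -{1}(funrposBneg f).
have E2 : EFin \o (avg K f \o X) =
    (fun w => (avg K f^\+%R (X w))%:E - (avg K f^\-%R (X w))%:E).
  apply/funext => w /=; rewrite -EFinB -avgB//; congr (avg _ _ _)%:E.
  by rewrite -{1}(funrposBneg f).
rewrite -[\int[m]_w _]/(\int[m]_w (EFin \o (avg K f \o X)) w) E2 E1.
rewrite !integralB_EFin// Ep En; split => //.
exact: (integrableB measurableT mp mn).
Qed.

End signed_mixture.

(** * Lipschitz functions for a metric on the state space *)

Section lipschitz.
Context (T : Type) (R : realType) (rho : T -> T -> R).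
Hypothesis rho_metric : is_metric rho.
Implicit Types (f g : T -> R) (c : R).

Let rho_ge0 := is_metric_ge0 rho_metric.

Lemma is_metric_refl x : rho x x = 0%R.
Proof. exact/(is_metric_eq0 rho_metric). Qed.

Lemma is_metric_gt0 x y : x <> y -> (0 < rho x y)%R.
Proof.
move=> xy; rewrite lt_neqAle rho_ge0 andbT eq_sym.
by apply/eqP => /(is_metric_eq0 rho_metric).
Qed.

Definition lip_bound c f := forall x y, (`|f x - f y| <= c * rho x y)%R.

Lemma lip_norm_leP c f : (lip_norm rho f <= c%:E) <-> lip_bound c f.
Proof.
split=> [fc x y|fc].
  have [->|xy] := pselect (x = y); first by rewrite subrr normr0 is_metric_refl mulr0.
  rewrite -ler_pdivrMr ?is_metric_gt0// -lee_fin (le_trans _ fc)//.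
  by apply: ereal_sup_ubound; exists (x, y).
apply: ge_ereal_sup => _ [[x y] /= xy <-].
by rewrite lee_fin ler_pdivrMr ?is_metric_gt0.
Qed.

Lemma lip_norm_ge0 f : (exists x y : T, x <> y) -> 0 <= lip_norm rho f.
Proof.
move=> [x [y xy]]; apply: (@le_trans _ _ (`|f x - f y| / rho x y)%:E).
  by rewrite lee_fin divr_ge0.
by apply: ereal_sup_ubound; exists (x, y).
Qed.

Lemma lip_bound_le c c' f : (c <= c')%R -> lip_bound c f -> lip_bound c' f.
Proof. by move=> cc' fc x y; rewrite (le_trans (fc x y))// ler_wpM2r. Qed.

Lemma lip_boundD c c' f g : lip_bound c f -> lip_bound c' g ->
  lip_bound (c + c') (fun x => f x + g x)%R.
Proof.
move=> fc gc x y; rewrite opprD addrACA (le_trans (ler_normD _ _))//.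
by rewrite mulrDl lerD.
Qed.

Lemma lip_bound_sum n (c : nat -> R) (f : nat -> T -> R) :
  (forall i, lip_bound (c i) (f i)) ->
  lip_bound (\sum_(0 <= i < n) c i)%R (fun x => \sum_(0 <= i < n) f i x)%R.
Proof.
move=> fc x y; rewrite -sumrB (le_trans (ler_norm_sum _ _ _))//.
by rewrite mulr_suml; apply: ler_sum => i _; exact: fc.
Qed.

Lemma lip_bound_norm c f : lip_bound c f -> lip_bound c (fun x => `|f x|)%R.
Proof. by move=> fc x y; rewrite (le_trans (ler_dist_dist _ _)). Qed.

Lemma lip_bound_dist x0 : lip_bound 1 (rho x0).
Proof.
move=> x y; rewrite mul1r ler_norml.
have := is_metric_triangle rho_metric x0 y x.
rewrite (is_metric_sym rho_metric y x).
by have := is_metric_triangle rho_metric x0 x y; lra.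
Qed.

End lipschitz.

Lemma integrable_cst_mass1 d (T : measurableType d) (R : realType)
    (mu : {measure set T -> \bar R}) (a : R) :
  mu setT = 1 -> mu.-integrable setT (EFin \o cst a).
Proof.
move=> muT; apply/integrableP; split; first exact/measurable_EFinP/measurable_cst.
rewrite (eq_integral (cst `|a|%:E))//.
by rewrite integral_cst// muT mule1 ltry.
Qed.

Lemma bounded_integrable_mass1 d (T : measurableType d) (R : realType)
    (mu : {measure set T -> \bar R}) (f : T -> R) (a : R) :
  mu setT = 1 -> measurable_fun setT f -> (forall x, (0 <= f x <= a)%R) ->
  mu.-integrable setT (EFin \o f).
Proof.
move=> muT mf f0a.
apply: le_integrable (integrable_cst_mass1 a muT) => //; first exact/measurable_EFinP.
move=> x _ /=; have /andP[f0 fa] := f0a x.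
by rewrite lee_fin !ger0_norm// (le_trans f0).
Qed.

(** * Kernels acting on Lipschitz functions *)

Section lipschitz_kernels.
Context dT (T : measurableType dT) (R : realType) (rho : T -> T -> R).
Hypothesis rho_metric : is_metric rho.
Hypothesis m_rho : measurable_fun setT (fun p : T * T => rho p.1 p.2).
Implicit Types (K P : R.-pker T ~> T) (f g h : T -> R).

Let rho_ge0 := is_metric_ge0 rho_metric.

Lemma lip_spaceP f : lip_space rho f <->
  measurable_fun setT f /\ exists2 c : R, (0 <= c)%R & lip_bound rho c f.
Proof.
split=> -[mf]; last first.
  move=> [c _ fc]; split=> //.
  by rewrite (le_lt_trans _ (ltry c))//; exact/lip_norm_leP.
move=> foo; split=> //; exists (Num.max (fine (lip_norm rho f)) 0%R).
  by rewrite le_max lexx orbT.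
apply/lip_norm_leP => //; case: (lip_norm rho f) foo => [r _|//|_]; last exact: leNye.
by rewrite lee_fin le_max lexx.
Qed.

Lemma measurable_dist x0 : measurable_fun setT (rho x0).
Proof.
by apply: (measurableT_comp m_rho (g := pair x0)); exact: measurable_pair1.
Qed.

Lemma lip_space_cst (a : R) : lip_space rho (cst a).
Proof.
apply/lip_spaceP; split; first exact: measurable_cst.
by exists 0%R => // x y; rewrite subrr normr0 mul0r.
Qed.

Lemma lip_space_dist x0 : lip_space rho (rho x0).
Proof.
apply/lip_spaceP; split; first exact: measurable_dist.
by exists 1%R => //; exact: lip_bound_dist.
Qed.

Lemma lip_spaceD f g : lip_space rho f -> lip_space rho g ->
  lip_space rho (fun x => f x + g x)%R.
Proof.
move=> /lip_spaceP[mf [c c0 fc]] /lip_spaceP[mg [c' c'0 gc]]; apply/lip_spaceP.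
split; first exact: measurable_funD.
by exists (c + c')%R; [rewrite addr_ge0|exact: lip_boundD].
Qed.

Lemma lip_space_norm f : lip_space rho f -> lip_space rho (fun x => `|f x|%R).
Proof.
move=> /lip_spaceP[mf [c c0 fc]]; apply/lip_spaceP; split.
  exact: measurableT_comp.
by exists c => //; exact: lip_bound_norm.
Qed.

(** A Lipschitz f is dominated by |f x0| + c rho x0. *)
Lemma lip_integrable (m : {measure set T -> \bar R}) x0 f : m setT = 1 ->
  lip_space rho f -> m.-integrable setT (EFin \o rho x0) ->
  m.-integrable setT (EFin \o f).
Proof.
move=> mT /lip_spaceP[mf [c c0 fc]] mx0.
have mgi : m.-integrable setT (EFin \o (fun y => `|f x0| + c * rho x0 y)%R).
  rewrite (_ : _ \o _ = (EFin \o cst `|f x0|%R) \+ (fun y => c%:E * (rho x0 y)%:E)).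
    apply: integrableD => //; last exact: integrableZl.
    exact: integrable_cst_mass1.
  by apply/funext => y /=; rewrite EFinD EFinM.
apply: le_integrable mgi => //; first exact/measurable_EFinP.
move=> y _ /=; rewrite lee_fin [leRHS]ger0_norm ?addr_ge0 ?mulr_ge0//.
have := fc y x0; rewrite (is_metric_sym rho_metric).
have := ler_normD (f x0) (f y - f x0)%R; rewrite addrC subrK; lra.
Qed.

Lemma coupling_fst (m1 m2 : {measure set T -> \bar R}) eta :
  coupling m1 m2 eta -> forall A, measurable A -> m1 A = eta (fst @^-1` A).
Proof. by move=> [+ _] A mA => <-//; rewrite setXT. Qed.

Lemma coupling_snd (m1 m2 : {measure set T -> \bar R}) eta :
  coupling m1 m2 eta -> forall A, measurable A -> m2 A = eta (snd @^-1` A).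
Proof. by move=> [_] + A mA => <-//; rewrite setTX. Qed.

(** The easy half of Kantorovich duality: integrate |f x - f y| <= c rho x y
    against the coupling. *)
Lemma coupling_lip_bound (m1 m2 : {measure set T -> \bar R})
    (eta : probability (T * T)%type R) (c a : R) f :
  coupling m1 m2 eta -> (0 <= c)%R -> lip_bound rho c f ->
  m1.-integrable setT (EFin \o f) -> m2.-integrable setT (EFin \o f) ->
  \int[eta]_p (rho p.1 p.2)%:E <= a%:E ->
  (`|Rintegral m1 setT f - Rintegral m2 setT f| <= c * a)%R.
Proof.
move=> cpl c0 fc f1 f2 etaa.
have mfst : measurable_fun setT (fst : T * T -> T) by exact: measurable_fst.
have msnd : measurable_fun setT (snd : T * T -> T) by exact: measurable_snd.
have i1 := integrable_law mfst (coupling_fst cpl) f1.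
have i2 := integrable_law msnd (coupling_snd cpl) f2.
rewrite -lee_fin EFinM.
have -> : `|Rintegral m1 setT f - Rintegral m2 setT f|%R%:E =
    `|\int[eta]_p (f p.1 - f p.2)%R%:E|.
  rewrite /Rintegral -abse_EFin EFinB !fineK ?integrable_fin_num//.
  under [in RHS]eq_integral do rewrite EFinB.
  rewrite integralB_EFin//; congr (`|_ - _|).
  - exact: (integral_law mfst (coupling_fst cpl) f1).
  - exact: (integral_law msnd (coupling_snd cpl) f2).
have mf12 : measurable_fun setT (fun p : T * T => (f p.1 - f p.2)%R%:E).
  exact: measurable_int (integrableB measurableT i1 i2).
apply: (le_trans (le_abse_integral _ _ _)) => //.
apply: (@le_trans _ _ (\int[eta]_p (c%:E * (rho p.1 p.2)%:E))).
  apply: ge0_le_integral => //.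
  - exact: measurableT_comp.
  - by apply: measurable_funeM; exact/measurable_EFinP.
  - by move=> [x y] _ /=; rewrite lee_fin.
rewrite ge0_integralZl//; last 2 first.
- exact/measurable_EFinP.
- by move=> p _; rewrite lee_fin.
by rewrite lee_wpmul2l// lee_fin.
Qed.

(** tau bounds an infimum over couplings; the slack e lets some coupling stay below
    the bound. *)
Lemma tau_coupling K (t e : R) x y : tau rho K <= t%:E -> (0 < e)%R -> x <> y ->
  exists2 eta, coupling (K x) (K y) eta &
    \int[eta]_p (rho p.1 p.2)%:E <= (t * rho x y + e)%:E.
Proof.
move=> Kt e0 xy; have xy0 := is_metric_gt0 rho_metric xy.
have : wasserstein rho (K x) (K y) < (t * rho x y + e)%:E.
  rewrite (@le_lt_trans _ _ (t%:E * (rho x y)%:E))//; last first.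
    by rewrite -EFinM lte_fin ltrDl.
  rewrite -lee_pdivrMr// (le_trans _ Kt)//; apply: ereal_sup_ubound => /=.
  by exists (x, y) => //=; rewrite inver gt_eqF.
by move=> /ereal_inf_lt[_ [eta cpl <-] /ltW]; exists eta.
Qed.

(** Near-optimal couplings of K x and K y, with the slack sent to 0. *)
Lemma lip_bound_avg K (t c : R) f :
  tau rho K <= t%:E -> (0 <= c)%R -> lip_bound rho c f ->
  (forall x, (K x).-integrable setT (EFin \o f)) ->
  lip_bound rho (c * t) (avg K f).
Proof.
move=> Kt c0 fc fi x y; have [->|xy] := pselect (x = y).
  by rewrite subrr normr0 is_metric_refl// mulr0.
apply/ler_addgt0Pl => e e0.
have c1 : (0 < c + 1)%R by rewrite ltr_wpDl.
have [eta cpl etale] := tau_coupling Kt (divr_gt0 e0 c1) xy.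
rewrite (le_trans (coupling_lip_bound cpl c0 fc (fi x) (fi y) etale))//.
rewrite mulrDr mulrA addrC lerD2r mulrCA ler_piMr// ?(ltW e0)//.
by rewrite ler_pdivrMr// mul1r lerDl.
Qed.

(** A finite contraction coefficient gives a coupling of K x1 and K x with finite
    cost, along which the triangle inequality moves the first moment. *)
Lemma integrable_dist_tau K (t : R) x0 x1 : tau rho K <= t%:E ->
  (K x1).-integrable setT (EFin \o rho x0) ->
  forall x, (K x).-integrable setT (EFin \o rho x0).
Proof.
move=> Kt i1 x; have [->//|xx1] := pselect (x = x1).
have [eta cpl etale] := tau_coupling Kt ltr01 xx1.
have mfst : measurable_fun setT (fst : T * T -> T) by exact: measurable_fst.
have msnd : measurable_fun setT (snd : T * T -> T) by exact: measurable_snd.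
have i2 := integrable_law msnd (coupling_snd cpl) i1.
have m0 : measurable_fun setT (EFin \o rho x0).
  by apply/measurable_EFinP; exact: measurable_dist.
apply/integrableP; split => //.
rewrite (ge0_integral_law mfst (coupling_fst cpl) (f := abse \o (EFin \o rho x0)))//.
- apply: (@le_lt_trans _ _
    (\int[eta]_p ((rho x0 p.2)%:E + (rho p.1 p.2)%:E))).
    apply: ge0_le_integral => //=.
    + do 2 apply: measurableT_comp => //.
      by apply: measurableT_comp => //; exact: measurable_dist.
    + apply/measurable_EFinP/measurable_funD => //.
      by apply: measurableT_comp => //; exact: measurable_dist.
    + move=> [a b] _ /=; rewrite -EFinD lee_fin ger0_norm//.
      have := is_metric_triangle rho_metric x0 b a.
      by rewrite (is_metric_sym rho_metric b a).
  rewrite ge0_integralD//.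
  + rewrite lte_add_pinfty//; last exact: le_lt_trans etale (ltry _).
    have := integrable_lty measurableT i2; exact.
  + by move=> p _; rewrite lee_fin.
  + by apply/measurable_EFinP/measurableT_comp => //; exact: measurable_dist.
  + by move=> p _; rewrite lee_fin.
  + exact/measurable_EFinP.
- by apply: measurableT_comp m0; exact: abse_measurable.
- by move=> y; exact: abse_ge0.
Qed.

End lipschitz_kernels.

(** * Iterates of the kernel *)

Section iterates.
Context dT (T : measurableType dT) (R : realType) (rho : T -> T -> R).
Hypothesis rho_metric : is_metric rho.
Hypothesis m_rho : measurable_fun setT (fun p : T * T => rho p.1 p.2).
Context (P : R.-pker T ~> T) (t : R).
Hypothesis t_ge0 : (0 <= t)%R.
Hypothesis tauP : tau rho P <= t%:E.
Hypothesis P_dist : forall x0 x, (P x).-integrable setT (EFin \o rho x0).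
Implicit Types f g h : T -> R.

Let rho_ge0 := is_metric_ge0 rho_metric.

Lemma lip_integrable_kernel f : lip_space rho f ->
  forall x, (P x).-integrable setT (EFin \o f).
Proof.
by move=> fL x; exact: (lip_integrable rho_metric (prob_kernel x) fL (P_dist x x)).
Qed.

Lemma lip_space_avg f : lip_space rho f -> lip_space rho (avg P f).
Proof.
move=> fL; have fi := lip_integrable_kernel fL.
have /(lip_spaceP rho_metric)[mf [c c0 fc]] := fL.
apply/(lip_spaceP rho_metric); split; first exact: measurable_avg.
by exists (c * t)%R; [rewrite mulr_ge0|exact: lip_bound_avg].
Qed.

Lemma lip_space_iter n f : lip_space rho f -> lip_space rho (iter n (avg P) f).
Proof. by move=> fL; elim: n => //= n; exact: lip_space_avg. Qed.

(** Turns bounds on tau (kernel_iter P n) into bounds on the iterates of avg P.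
    Integrability survives at each step because avg P preserves lip_space, so that
    the absolute value of f has finite iterated means. *)
Lemma kernel_iter_avg n f : lip_space rho f ->
  forall x, (kernel_iter P n x).-integrable setT (EFin \o f) /\
    avg (kernel_iter P n) f x = iter n (avg P) f x.
Proof.
elim: n f => [|n IH] f fL x.
  have /(lip_spaceP rho_metric)[mf _] := fL.
  have mEf : measurable_fun setT (EFin \o f) by exact/measurable_EFinP.
  split; last by rewrite /avg /Rintegral /= integral_dirac// diracT mul1e.
  apply/integrableP; split=> //; rewrite integral_dirac//.
    by rewrite diracT mul1e ltry.
  by apply: measurableT_comp mEf; exact: abse_measurable.
have mid : measurable_fun setT (@idfun T) by exact: measurable_id.
have QE A : measurable A ->
    kernel_iter P n.+1 x A = \int[P x]_y kernel_iter P n (idfun y) A by [].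
have nfL := lip_space_norm rho_metric fL.
have /(lip_spaceP rho_metric)[mf _] := fL.
have fi : (kernel_iter P n.+1 x).-integrable setT (EFin \o f).
  apply/integrableP; split; first exact/measurable_EFinP.
  rewrite (integral_kernel_mixture measurableT mid QE)//; last first.
    by apply: measurableT_comp; [exact: abse_measurable|exact/measurable_EFinP].
  rewrite (eq_integral (EFin \o iter n (avg P) (fun y => `|f y|)%R)).
    apply: integrable_lty => //; apply: lip_integrable_kernel.
    exact: lip_space_iter.
  by move=> y _ /=; have [nfi <-] := IH _ nfL y; rewrite EFin_avg.
have [_ E] := integral_kernel_mixture_signed mid QE (fun y => (IH f fL y).1) fi.
split=> //=; rewrite /avg /Rintegral E; congr fine.
by apply: eq_integral => y _; rewrite (IH f fL y).2.
Qed.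

Lemma lip_bound_iter_tau n (a c : R) f : tau rho (kernel_iter P n) <= a%:E ->
  (0 <= c)%R -> lip_space rho f -> lip_bound rho c f ->
  lip_bound rho (c * a) (iter n (avg P) f).
Proof.
move=> na c0 fL fc; rewrite (_ : iter _ _ _ = avg (kernel_iter P n) f).
  by apply: lip_bound_avg => // x; have [] := kernel_iter_avg n fL x.
by apply/funext => x; have [] := kernel_iter_avg n fL x.
Qed.

Lemma lip_bound_iter n (c : R) f :
  (0 <= c)%R -> lip_space rho f -> lip_bound rho c f ->
  lip_bound rho (c * t ^+ n) (iter n (avg P) f).
Proof.
move=> c0 fL fc; elim: n => [|n IH] /=; first by rewrite expr0 mulr1.
rewrite exprSr mulrA; apply: lip_bound_avg => //; first by rewrite mulr_ge0 ?exprn_ge0.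
by apply: lip_integrable_kernel; exact: lip_space_iter.
Qed.

(** Write i = q m + r: apply r single steps, then q blocks of m steps. *)
Lemma lip_bound_iter_blocks m (k : R) i (c : R) f : (0 <= k)%R ->
  tau rho (kernel_iter P m) <= k%:E ->
  (0 <= c)%R -> lip_space rho f -> lip_bound rho c f ->
  lip_bound rho (c * geometric_by_blocks k t m i) (iter i (avg P) f).
Proof.
move=> k0 mk c0 fL fc; rewrite {2}(divn_eq i m) iterD /geometric_by_blocks.
rewrite mulrCA mulrC; move: (i %/ m)%N (i %% m)%N => q r.
have ctr0 : (0 <= c * t ^+ r)%R by rewrite mulr_ge0 ?exprn_ge0.
elim: q => [|q IH]; first by rewrite expr0 mulr1 mul0n; exact: lip_bound_iter.
rewrite exprSr mulrA mulSn iterD; apply: lip_bound_iter_tau => //.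
  by rewrite mulr_ge0 ?exprn_ge0.
by do 2 apply: lip_space_iter.
Qed.

Lemma iter_avgD n f g : lip_space rho f -> lip_space rho g ->
  iter n (avg P) (fun x => f x + g x)%R =
  (fun x => iter n (avg P) f x + iter n (avg P) g x)%R.
Proof.
move=> fL gL; elim: n => //= n ->; apply/funext => x.
by apply: RintegralD => //; apply: lip_integrable_kernel; exact: lip_space_iter.
Qed.

End iterates.

(** * Poisson's equation *)

Section ae_witness.
Context d (T : measurableType d) (R : realType) (m : probability T R).

Lemma ge0_integral_lty_witness (f : T -> \bar R) : (forall x, 0 <= f x) ->
  \int[m]_x f x < +oo -> exists x, f x < +oo.
Proof.
move=> f0; apply: contraPP => /forallNP foo.
rewrite (eq_integral (cst +oo)); last first.
  by move=> x _; have /negP := foo x; rewrite -leNgt leye_eq => /eqP.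
by rewrite integral_cst// [X in _ * X]probability_setT mule1 ltxx.
Qed.

End ae_witness.

Section poisson.
Context dT (T : measurableType dT) (R : realType) (rho : T -> T -> R).
Hypothesis rho_metric : is_metric rho.
Hypothesis m_rho : measurable_fun setT (fun p : T * T => rho p.1 p.2).
Context (P : R.-pker T ~> T) (t : R).
Hypothesis t_ge0 : (0 <= t)%R.
Hypothesis tauP : tau rho P <= t%:E.
Context (pi : probability T R).
Hypothesis pi_dist : forall x, pi.-integrable setT (EFin \o rho x).
Implicit Types f g u : T -> R.

Let rho_ge0 := is_metric_ge0 rho_metric.

Section mean_zero.

Lemma lip_integrable_pi f : lip_space rho f -> pi.-integrable setT (EFin \o f).
Proof.
move=> fL.
exact: (lip_integrable rho_metric (probability_setT pi) fL (pi_dist point)).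
Qed.

Definition mean_dist x : R := Rintegral pi setT (rho x).

Lemma mean_dist_ge0 x : (0 <= mean_dist x)%R.
Proof. exact: Rintegral_ge0. Qed.

(** f x is the pi-mean of f x - f y. *)
Lemma mean_zero_le f (c : R) x : lip_space rho f -> lip_bound rho c f ->
  \int[pi]_x (f x)%:E = 0 -> (`|f x| <= c * mean_dist x)%R.
Proof.
move=> fL fc f0; have fi := lip_integrable_pi fL.
have ci : pi.-integrable setT (EFin \o (fun _ : T => f x)).
  exact: finite_measure_integrable_cst.
have -> : f x = Rintegral pi setT (fun y => f x - f y)%R.
  rewrite RintegralB// {2}/Rintegral f0 subr0 Rintegral_cst//.
  by rewrite [X in fine X]probability_setT mulr1.
have fxi : pi.-integrable setT (EFin \o (fun y => f x - f y)%R).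
  rewrite (_ : _ \o _ = (EFin \o (fun=> f x)) \- (EFin \o f)) ?integrableB//.
rewrite (le_trans (le_normr_Rintegral _ _))//.
rewrite -RintegralZl//; apply: le_Rintegral => //.
- exact: (integrable_norm fxi).
- have := @integrableZl _ _ _ pi setT measurableT c (EFin \o rho x) (pi_dist x).
  by apply: eq_integrable.
Qed.

End mean_zero.

Hypothesis pi_inv : Defs.invariant P pi.

Let mid : measurable_fun setT (@idfun T) := @measurable_id _ _ _.

Let pi_invE A : measurable A -> pi A = \int[pi]_x P (idfun x) A.
Proof. by move=> mA; rewrite pi_inv. Qed.

(** By invariance the P(x, .)-means of rho x0 have a finite pi-mean, so one of
    them is finite, and then they all are. *)
Lemma invariant_integrable_dist x0 x : (P x).-integrable setT (EFin \o rho x0).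
Proof.
have m0 : measurable_fun setT (EFin \o rho x0).
  by apply/measurable_EFinP; exact: measurable_dist.
have [x1 x1oo] : exists x1, \int[P x1]_y (rho x0 y)%:E < +oo.
  apply: (@ge0_integral_lty_witness _ _ _ pi).
    by move=> y; apply: integral_ge0 => z _; rewrite lee_fin.
  rewrite -(integral_kernel_mixture measurableT mid pi_invE m0).
    by apply: integrable_lty => //; exact: pi_dist.
  by move=> y; rewrite lee_fin.
apply: (integrable_dist_tau rho_metric m_rho tauP (x1 := x1)).
apply/integrableP; split => //; under eq_integral do rewrite /= ger0_norm//.
exact: x1oo.
Qed.

Let P_dist := invariant_integrable_dist.
Let lipP := lip_integrable_kernel rho_metric P_dist.
Let lip_iter n f (fL : lip_space rho f) :=
  lip_space_iter rho_metric m_rho t_ge0 tauP P_dist n fL.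

Lemma integral_pi_avg f : lip_space rho f ->
  \int[pi]_x (avg P f x)%:E = \int[pi]_x (f x)%:E.
Proof.
move=> fL.
by have [_ ->] := integral_kernel_mixture_signed mid pi_invE (lipP fL)
  (lip_integrable_pi fL).
Qed.

Context (m : nat) (k : R).
Hypothesis m_gt0 : (0 < m)%N.
Hypothesis k_ge0 : (0 <= k)%R.
Hypothesis k_lt1 : (k < 1)%R.
Hypothesis tauPm : tau rho (kernel_iter P m) <= k%:E.

Let b := geometric_by_blocks k t m.
Let b_ge0 i : (0 <= b i)%R. Proof. exact: geometric_by_blocks_ge0. Qed.
Let cvg_b : cvgn (series b).
Proof. exact: cvg_series_geometric_by_blocks. Qed.

Let lip_bound_it i (c : R) f (c0 : (0 <= c)%R) (fL : lip_space rho f)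
    (fc : lip_bound rho c f) : lip_bound rho (c * b i) (iter i (avg P) f) :=
  lip_bound_iter_blocks rho_metric m_rho t_ge0 tauP P_dist i k_ge0 tauPm c0 fL fc.

(** Dominated convergence: an equi-Lipschitz sequence that is bounded at x0 is
    dominated by A + C rho x0. *)
Lemma lip_bound_cvg_integral (mu : {measure set T -> \bar R}) (s : nat -> T -> R) u
    (C A : R) x0 : mu setT = 1 ->
  mu.-integrable setT (EFin \o rho x0) ->
  (forall n, measurable_fun setT (s n)) -> (forall n, lip_bound rho C (s n)) ->
  (forall n, `|s n x0| <= A)%R -> (0 <= C)%R ->
  (forall x, s n x @[n --> \oo] --> u x) ->
  \int[mu]_y (s n y)%:E @[n --> \oo] --> \int[mu]_y (u y)%:E.
Proof.
move=> muT mux0 ms sC sA C0 su.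
apply: (@dominated_cvg _ _ _ mu setT measurableT (fun n y => (s n y)%:E)
  (EFin \o u) (fun y => (A + C * rho x0 y)%:E)) => //.
- by move=> n; exact/measurable_EFinP.
- by move=> y _; apply: cvg_EFin; [exact: nearW|exact: su].
- rewrite (_ : (fun _ => _) = (EFin \o cst A) \+ (fun y => C%:E * (rho x0 y)%:E)).
    apply: integrableD => //; last exact: integrableZl.
    exact: integrable_cst_mass1.
  by apply/funext => y /=; rewrite EFinD EFinM.
- move=> n y _; rewrite lee_fin.
  have := sC n y x0; rewrite (is_metric_sym rho_metric).
  have := ler_normD (s n x0) (s n y - s n x0)%R; rewrite addrC subrK.
  by have := sA n; lra.
Qed.

(** The solution is the Neumann series of g.  Its partial sums are equi-Lipschitz
    and bounded at each point, so that limits pass through pi and P(x, .). *)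
Lemma poisson_exists g : lip_space0 rho pi g ->
  exists u, lip_space0 rho pi u /\ forall x, (u x - avg P u x = g x)%R.
Proof.
move=> [gL g0]; have /(lip_spaceP rho_metric)[mg [c c0 gc]] := gL.
pose a i := iter i (avg P) g.
have aL i : lip_space rho (a i) by exact: lip_iter.
have a0 i : \int[pi]_x (a i x)%:E = 0.
  elim: i => [|i IH]; first exact: g0.
  by rewrite -[RHS]IH -(integral_pi_avg (aL i)).
have ac i : lip_bound rho (c * b i) (a i) by exact: lip_bound_it.
pose s n x := (\sum_(0 <= i < n) a i x)%R.
pose B := limn (series b).
have sB n : (series b n <= B)%R.
  apply: nondecreasing_cvgn_le => //.
  by apply: nondecreasing_series => i _ _; exact: b_ge0.
have sc n : lip_bound rho (c * B) (s n).
  apply: (lip_bound_le rho_metric (c := \sum_(0 <= i < n) c * b i)%R).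
    by rewrite -mulr_sumr ler_wpM2l//; exact: sB.
  exact: lip_bound_sum.
have sL n : lip_space rho (s n).
  elim: n => [|n IH].
    rewrite (_ : s 0%N = cst 0%R); first exact: lip_space_cst.
    by apply/funext => x; rewrite /s big_geq.
  rewrite (_ : s n.+1 = fun x => s n x + a n x)%R; first exact: lip_spaceD.
  by apply/funext => x; rewrite /s big_nat_recr.
have s0 n : \int[pi]_x (s n x)%:E = 0.
  rewrite /s; under eq_integral do rewrite -sumEFin.
  rewrite integral_sum//; first by rewrite big1.
  by move=> i; exact: lip_integrable_pi.
have cvg_s x : cvgn (s ^~ x).
  apply: (@normed_cvg R R^o (a ^~ x)).
  apply: (@series_le_cvg R _ (fun i => c * mean_dist x * b i)%R).
  - by move=> i; exact: normr_ge0.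
  - by move=> i; rewrite mulr_ge0 ?b_ge0// mulr_ge0// mean_dist_ge0.
  - by move=> i; rewrite mulrAC; exact: mean_zero_le.
  - exact: is_cvg_seriesZ.
pose u x := limn (s ^~ x).
have su x : s n x @[n --> \oo] --> u x by exact: cvg_s.
have cB0 : (0 <= c * B)%R.
  by rewrite mulr_ge0// (le_trans _ (sB 0%N))// /series/= big_geq.
have ms n : measurable_fun setT (s n).
  by have /(lip_spaceP rho_metric)[] := sL n.
have uL : lip_space rho u.
  apply/(lip_spaceP rho_metric); split.
    by apply: (measurable_fun_cvg ms) => x _; exact: su.
  exists (c * B)%R => // x y.
  have cv : (`|s n x - s n y| @[n --> \oo] --> `|u x - u y|)%R.
    by apply: cvg_norm; apply: cvgB; exact: su.
  rewrite -(cvg_lim _ cv)//; apply: limr_le; first by apply/cvg_ex; eexists; exact: cv.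
  by apply: nearW => n; exact: sc.
have sA n x : (`|s n x| <= c * B * mean_dist x)%R.
  exact: mean_zero_le.
exists u; split.
  split=> //.
  have := lip_bound_cvg_integral (probability_setT pi) (pi_dist point) ms sc
    (sA ^~ point) cB0 su.
  under eq_fun do rewrite s0.
  by move=> h; rewrite -(cvg_lim _ h)// lim_cst.
move=> x.
have avg_s n : avg P (s n) x = (s n.+1 x - g x)%R.
  elim: n => [|n IH].
    rewrite {2}/s big_nat1 subrr /avg (_ : s 0%N = cst 0%R) ?Rintegral_cst ?mul0r//.
    by apply/funext => y; rewrite /s big_geq.
  rewrite (_ : s n.+1 = fun y => s n y + a n y)%R; last first.
    by apply/funext => y; rewrite /s big_nat_recr.
  rewrite [LHS]RintegralD//; [|exact: lipP|exact: lipP].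
  by rewrite -/(avg P (s n) x) IH /s [in RHS]big_nat_recr//= addrAC.
have := lip_bound_cvg_integral (prob_kernel x) (P_dist x x) ms sc (sA ^~ x) cB0 su.
under eq_fun do rewrite -EFin_avg ?lipP// avg_s.
rewrite -EFin_avg ?lipP// => /fine_cvgP[_] h.
have h2 : (s n.+1 x - g x)%R @[n --> \oo] --> (u x - g x)%R.
  by apply: cvgB; [rewrite (cvg_shiftS (s ^~ x)); exact: su|exact: cvg_cst].
have := cvg_unique (@Rhausdorff R) h h2; rewrite /= => ->.
by rewrite opprB addrC subrK.
Qed.

Lemma poisson_iter g u n : lip_space rho g -> lip_space rho u ->
  (forall x, (u x - avg P u x = g x)%R) ->
  forall x, u x = (\sum_(0 <= i < n) iter i (avg P) g x + iter n (avg P) u x)%R.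
Proof.
move=> gL uL ug; elim: n => [|n IH] x; first by rewrite big_geq// add0r.
rewrite big_nat_recr//= -addrA IH; congr (_ + _)%R.
have uE : u = (fun x => g x + avg P u x)%R.
  by apply/funext => y; rewrite -ug subrK.
rewrite {1}uE (iter_avgD rho_metric m_rho t_ge0 tauP P_dist)//;
  last exact: (@lip_iter 1).
by rewrite -iterSr.
Qed.

Hypothesis nontriv : exists x y : T, x <> y.

Lemma tau_ge0 (K : R.-pker T ~> T) : 0 <= tau rho K.
Proof.
have [x [y xy]] := nontriv.
apply: (@le_trans _ _ (wasserstein rho (K x) (K y) / (rho x y)%:E)).
  apply: mule_ge0; last by rewrite inver gt_eqF ?is_metric_gt0// lee_fin invr_ge0.
  apply: le_ereal_inf_tmp => _ [eta _ <-].
  by apply: integral_ge0 => p _; rewrite lee_fin.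
by apply: ereal_sup_ubound; exists (x, y).
Qed.

(** Pass to the limit in poisson_iter, where the sum contributes at most Lambda.
    The constant is real, whereas Lambda may be infinite; this is why a Lipschitz
    constant of u below Lambda is asserted to exist, rather than an inequality
    for the least one. *)
Lemma poisson_lip_bound g u :
  lip_space rho g -> lip_bound rho 1 g -> lip_space rho u ->
  (forall x, (u x - avg P u x = g x)%R) ->
  exists c : R, [/\ (0 <= c)%R, lip_bound rho c u & c%:E <= Lambda rho P].
Proof.
move=> gL g1 uL ug; have /(lip_spaceP rho_metric)[mu [c c0 uc]] := uL.
have tau0 i : 0 <= tau rho (kernel_iter P i) by exact: tau_ge0.
have L0 : 0 <= Lambda rho P by exact: nneseries_ge0.
have [Loo|Loo] := ltP (Lambda rho P) +oo; last first.
  by exists c; split => //; rewrite (le_trans _ Loo)// leey.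
have Lfin : Lambda rho P \is a fin_num by rewrite ge0_fin_numE.
exists (fine (Lambda rho P)); split; [exact: fine_ge0| |by rewrite fineK].
pose l i := fine (tau rho (kernel_iter P i)).
have sumL n : (\sum_(0 <= i < n) tau rho (kernel_iter P i) <= Lambda rho P)%E.
  exact: nneseries_lim_ge.
have lE i : (l i)%:E = tau rho (kernel_iter P i).
  rewrite fineK// ge0_fin_numE// (le_lt_trans _ Loo)// (le_trans _ (sumL i.+1))//.
  by rewrite big_nat_recr//= leeDr// sume_ge0.
move=> x y.
have bound n : (`|u x - u y| <= fine (Lambda rho P) * rho x y + c * b n * rho x y)%R.
  rewrite (poisson_iter n gL uL ug x) (poisson_iter n gL uL ug y).
  rewrite opprD addrACA (le_trans (ler_normD _ _))// lerD//; last exact: lip_bound_it.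
  apply: (@le_trans _ _ ((\sum_(0 <= i < n) 1 * l i) * rho x y)%R).
    apply: (@lip_bound_sum _ _ rho n (fun i => 1 * l i)%R
      (fun i => iter i (avg P) g)) => i.
    by apply: (lip_bound_iter_tau rho_metric m_rho t_ge0 tauP P_dist) => //; rewrite lE.
  rewrite ler_wpM2r//; under eq_bigr do rewrite mul1r.
  rewrite -lee_fin -sumEFin fineK//; under eq_bigr do rewrite lE.
  exact: sumL.
have cv : (fine (Lambda rho P) * rho x y + c * b n * rho x y)%R @[n --> \oo] -->
    (fine (Lambda rho P) * rho x y + c * 0 * rho x y)%R.
  apply: cvgD; first exact: cvg_cst.
  apply: cvgMr_tmp; apply: cvgMl_tmp; exact: (cvg_series_cvg_0 cvg_b).
move: cv; rewrite mulr0 mul0r addr0 => cv.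
rewrite -(cvg_lim _ cv)//; apply: limr_ge; first by apply/cvg_ex; eexists; exact: cv.
exact: nearW.
Qed.

End poisson.

(** * Moments along the chain *)

Section lnorm_facts.
Context d (T : measurableType d) (R : realType).
Implicit Types (m : {measure set T -> \bar R}) (s q : R).
Local Open Scope charge_scope.

Lemma le_poweR (x y : \bar R) s : (0 <= s)%R -> 0 <= x -> x <= y ->
  x `^ s <= y `^ s.
Proof.
move=> s0 x0 xy; apply: gt0_ler_poweR => //; rewrite in_itv/= leey andbT//.
exact: le_trans xy.
Qed.

Lemma LnormE m s (f : T -> \bar R) :
  'N[m]_s%:E[f] = (\int[m]_x `|f x| `^ s) `^ s^-1.
Proof. by rewrite unlock. Qed.

(** Jensen's inequality for the power s, as Hoelder's inequality against the
    constant 1. *)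
Lemma expectation_le_Lnorm m s q (f : T -> R) : m setT = 1 ->
  (0 < s)%R -> (0 < q)%R -> (q^-1 + s^-1 = 1)%R ->
  measurable_fun setT f -> (forall x, (0 <= f x)%R) ->
  \int[m]_x (f x)%:E <= 'N[m]_s%:E[EFin \o f].
Proof.
move=> mT s0 q0 qs mf f0.
have := @hoelder _ _ _ m f (cst 1%R) s q mf (measurable_cst _) s0 q0.
rewrite addrC qs => /(_ erefl).
rewrite (_ : EFin \o cst 1%R = cst 1)// Lnorm_cst1 mT poweR1r mule1.
rewrite Lnorm1; under eq_integral do rewrite /= mulr1 ger0_norm//.
exact.
Qed.

(** Boundedness of f makes it nu-integrable, so that the change of variables by
    the density applies; unbounded functions are reached by truncation. *)
Lemma density_le_Lnorm (pi nu : probability T R) s q (f : T -> R) A :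
  nu `<< pi -> (0 < s)%R -> (0 < q)%R -> (q^-1 + s^-1 = 1)%R ->
  measurable_fun setT f -> (forall x, (0 <= f x <= A)%R) ->
  \int[nu]_x (f x)%:E <=
    'N[pi]_q%:E['d (charge_of_finite_measure nu) '/d pi] * 'N[pi]_s%:E[EFin \o f].
Proof.
move=> nupi s0 q0 qs mf f0A.
have fi : nu.-integrable setT (EFin \o f).
  exact: bounded_integrable_mass1 (probability_setT nu) mf f0A.
rewrite -(Radon_Nikodym_change_of_variables nupi)//.
set w := 'd _ '/d pi.
pose v x := fine (w x).
have vE x : (v x)%:E = w x by rewrite fineK//; exact: Radon_Nikodym_fin_num.
have mw : measurable_fun setT w.
  by apply: measurable_int; exact: Radon_Nikodym_integrable.
have mv : measurable_fun setT v.
  by apply: (measurableT_comp (@fine_measurable _ setT _)).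
have -> : 'N[pi]_q%:E[w] = 'N[pi]_q%:E[EFin \o v].
  by apply: eq_Lnorm => x; rewrite /= vE.
have := @hoelder _ _ _ pi v f q s mv mf q0 s0 qs; apply: le_trans.
rewrite Lnorm1; apply: (le_trans (lee_abs _)).
apply: (le_trans (le_abse_integral _ _ _)) => //.
  by apply: emeasurable_funM => //; exact/measurable_EFinP.
by under eq_integral do rewrite -vE -EFinM mulrC.
Qed.

(** K contracts L^s of an invariant measure: Jensen's inequality at each point,
    then invariance applied to f^s. *)
Lemma Lnorm_avg (pi : probability T R) (K : R.-pker T ~> T) s q (f : T -> R) A :
  Defs.invariant K pi -> (0 < s)%R -> (0 < q)%R -> (q^-1 + s^-1 = 1)%R ->
  measurable_fun setT f -> (forall x, (0 <= f x <= A)%R) ->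
  'N[pi]_s%:E[EFin \o avg K f] <= 'N[pi]_s%:E[EFin \o f].
Proof.
move=> Kpi s0 q0 qs mf f0A.
have f0 x : (0 <= f x)%R by have /andP[] := f0A x.
have fi x : (K x).-integrable setT (EFin \o f).
  exact: bounded_integrable_mass1 (prob_kernel x) mf f0A.
have mfs : measurable_fun setT (fun x => `|(f x)%:E| `^ s).
  apply: (measurableT_comp (measurable_poweR s)).
  by apply: measurableT_comp; [exact: abse_measurable|exact/measurable_EFinP].
rewrite !LnormE; apply: le_poweR; first by rewrite invr_ge0 ltW.
  by apply: integral_ge0 => x _; exact: poweR_ge0.
rewrite [leRHS](integral_kernel_mixture (K := K) (X := idfun) (m := pi) measurableT)//.
- apply: ge0_le_integral => //.
  + by move=> x _; exact: poweR_ge0.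
  + apply: (measurableT_comp (measurable_poweR s)).
    apply: measurableT_comp; first exact: abse_measurable.
    by apply/measurable_EFinP; exact: measurable_avg.
  + apply: measurable_fun_integral_kernel => //.
    * by move=> A' mA'; exact: measurable_kernel.
    * by move=> x; exact: poweR_ge0.
  + move=> x _; have s1 : (s != 0)%R by rewrite gt_eqF.
    have -> := esym (poweR_Lnorm (K x) (EFin \o f) s1).
    apply: le_poweR; [exact: ltW|exact: abse_ge0|].
    rewrite gee0_abs ?lee_fin ?avg_ge0//= EFin_avg//.
    apply: expectation_le_Lnorm q0 qs mf f0 => //; exact: prob_kernel.
- exact: measurable_id.
- by move=> A' mA'; apply/esym/Kpi.
- by move=> x; exact: poweR_ge0.
Qed.

End lnorm_facts.

Section history.
Context d (T : measurableType d) d' (Omega : measurableType d').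
Implicit Types X : nat -> {mfun Omega >-> T}.

(** The generating family of history, named so that g_sigma_algebraType turns the
    past into a measurable type. *)
Definition history_generator X n : set (set Omega) :=
  \bigcup_(k in [set k | (1 <= k <= n)%N])
    preimage_set_system [set: Omega] (X k) measurable.

Lemma history_measurable X n : <<s history_generator X n >> `<=` measurable.
Proof.
apply: smallest_sub; first exact: sigma_algebra_measurable.
move=> _ [k _ [A mA <-]].
exact: (@measurable_funP _ _ _ _ setT (X k) measurableT A mA).
Qed.

Lemma measurable_history X n k : (1 <= k <= n)%N ->
  measurable_fun (setT : set (g_sigma_algebraType (history_generator X n))) (X k).
Proof.
move=> kn _ A mA; apply: sub_sigma_algebra; exists k => //; exists A => //.
Qed.

End history.

Section truncation.
Context (T : Type) (R : realType).

Definition truncate (f : T -> R) (k : nat) x : R := Num.min (f x) k%:R.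

Lemma truncate_bound f k x : (forall x, (0 <= f x)%R) ->
  (0 <= truncate f k x <= k%:R)%R.
Proof. by move=> f0; rewrite le_min f0 ler0n /= ge_min lexx orbT. Qed.

Lemma truncate_le f k x : (truncate f k x <= f x)%R.
Proof. by rewrite ge_min lexx. Qed.

Lemma nondecreasing_truncate f x :
  {homo truncate f ^~ x : k l / (k <= l)%N >-> (k <= l)%R}.
Proof. by move=> k l kl; rewrite /truncate le_min !ge_min lexx ler_nat kl orbT. Qed.

Lemma cvg_truncate f x : truncate f k x @[k --> \oo] --> f x.
Proof.
apply: cvg_near_cst; near=> k; rewrite /truncate; apply/min_idPl.
near: k; exact: nbhs_infty_ger.
Unshelve. all: by end_near. Qed.

End truncation.

Section chain_moments.
Context d (T : measurableType d) d' (Omega : measurableType d') (R : realType).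
Context (Pr : probability Omega R) (X : nat -> {mfun Omega >-> T}).
Context (P : R.-pker T ~> T) (nu pi : probability T R).
Hypothesis X_chain : markov_chain Pr X P nu.
Hypothesis pi_inv : Defs.invariant P pi.
Hypothesis nu_pi : nu `<< pi.
Context (q s : R).
Hypothesis q_gt0 : (0 < q)%R.
Hypothesis s_gt0 : (0 < s)%R.
Hypothesis qs : (q^-1 + s^-1 = 1)%R.
Local Open Scope charge_scope.

Let D := 'N[pi]_q%:E['d (charge_of_finite_measure nu) '/d pi].

(** Induction on time with f varying: one step back replaces f by Pf, whose
    L^s(pi) norm is not larger. *)
Lemma chain_bounded_moment n (f : T -> R) A : measurable_fun setT f ->
  (forall x, (0 <= f x <= A)%R) ->
  \int[Pr]_w (f (X n.+1 w))%:E <= D * 'N[pi]_s%:E[EFin \o f].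
Proof.
elim: n f => [|n IH] f mf f0A; have f0 x : (0 <= f x)%R by have /andP[] := f0A x.
  rewrite -(@ge0_integral_law _ _ _ _ _ Pr nu (X 1%N) _ _ (EFin \o f))//.
  - exact: density_le_Lnorm f0A.
  - by move=> B mB; apply/esym/(X_chain.1 B).
  - exact/measurable_EFinP.
have fi x : (P x).-integrable setT (EFin \o f).
  exact: bounded_integrable_mass1 (prob_kernel x) mf f0A.
have hT : <<s history_generator X n.+1 >> setT.
  exact: (@measurableT _ (g_sigma_algebraType (history_generator X n.+1))).
rewrite (one_step_ge0_event (K := P) (X := X n.+1) _ _ _ _ hT (f := EFin \o f))//.
- under eq_integral do rewrite -EFin_avg//.
  rewrite (le_trans (IH (avg P f) _ _))//.
  + exact: measurable_avg.
  + move=> x; rewrite avg_ge0//= -lee_fin EFin_avg//.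
    rewrite (@le_trans _ _ (\int[P x]_y (cst A%:E) y))//.
      apply: ge0_le_integral => //.
      * by move=> y _; rewrite lee_fin.
      * exact/measurable_EFinP.
      * by move=> y _; rewrite lee_fin; have /andP[] := f0A y.
    by rewrite integral_cst// [X in _ * X]prob_kernel mule1.
  + apply: lee_wpmul2l; first exact: Lnorm_ge0.
    exact: Lnorm_avg pi_inv s_gt0 q_gt0 qs mf f0A.
- exact: history_measurable.
- by move=> B C GB mC; apply: X_chain.2.
- exact/measurable_EFinP.
Qed.

Lemma chain_moment n (f : T -> R) (V : \bar R) : measurable_fun setT f ->
  (forall x, (0 <= f x)%R) ->
  (forall k, 'N[pi]_s%:E[EFin \o truncate f k] <= V) ->
  \int[Pr]_w (f (X n.+1 w))%:E <= D * V.
Proof.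
move=> mf f0 fV.
have mt k : measurable_fun setT (truncate f k).
  by apply: measurable_minr => //; exact: measurable_cst.
have cv : \int[Pr]_w (truncate f k (X n.+1 w))%:E @[k --> \oo] -->
    \int[Pr]_w (f (X n.+1 w))%:E.
  apply: (integral_like_cvg (integral_like_integral Pr)
    (f_ := fun k w => (truncate f k (X n.+1 w))%:E)
    (f := fun w => (f (X n.+1 w))%:E)).
  - by move=> k; apply/measurable_EFinP; exact: measurableT_comp.
  - by move=> k w; rewrite lee_fin; have /andP[] := truncate_bound k (X n.+1 w) f0.
  - by move=> w k l kl; rewrite lee_fin; exact: nondecreasing_truncate.
  - by move=> w; apply: cvg_EFin; [exact: nearW|exact: cvg_truncate].
rewrite -(cvg_lim _ cv)//; apply: lime_le; first by apply/cvg_ex; eexists; exact: cv.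
apply: nearW => k; apply: le_trans (chain_bounded_moment n (mt k) _) _.
  by move=> x; exact: truncate_bound.
by apply: lee_wpmul2l; first exact: Lnorm_ge0.
Qed.

End chain_moments.

Section lipschitz_moments.
Context dT (T : measurableType dT) (R : realType) (rho : T -> T -> R).
Hypothesis rho_metric : is_metric rho.
Hypothesis m_rho : measurable_fun setT (fun p : T * T => rho p.1 p.2).
Context (pi : probability T R).
Hypothesis pi_dist : forall x, pi.-integrable setT (EFin \o rho x).

Let rho_ge0 := is_metric_ge0 rho_metric.

Lemma E1E x : E1 rho pi x = (mean_dist rho pi x)%:E.
Proof.
rewrite /mean_dist /Rintegral fineK//.
by apply: integrable_fin_num => //; exact: pi_dist.
Qed.

Lemma measurable_E1 : measurable_fun setT (E1 rho pi).
Proof.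
apply: (measurable_fun_fubini_tonelli_F (m2 := pi) (fun p => (rho p.1 p.2)%:E)).
- exact/measurable_EFinP.
- by move=> p; rewrite lee_fin.
Qed.

(** |u| <= c E_1 turns the L^s norm of u^2 into the square of the L^(2s) norm of
    c E_1. *)
Lemma Lnorm_truncate_sqr (u : T -> R) (c s : R) k : (0 < s)%R -> (0 <= c)%R ->
  measurable_fun setT u -> (forall x, (`|u x| <= c * mean_dist rho pi x)%R) ->
  'N[pi]_s%:E[EFin \o truncate (fun x => u x ^+ 2)%R k] <=
  (c%:E * eps rho pi (2 * s)) ^+ 2.
Proof.
move=> s0 c0 mu uc.
have s20 : (0 < 2 * s)%R by rewrite mulr_gt0.
have e0 x : (0 <= mean_dist rho pi x)%R by apply: Rintegral_ge0.
have mE1r : measurable_fun setT (fun x => `|E1 rho pi x| `^ (2 * s)).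
  apply: (measurableT_comp (measurable_poweR _)).
  by apply: measurableT_comp; [exact: abse_measurable|exact: measurable_E1].
pose Y := \int[pi]_x `|E1 rho pi x| `^ (2 * s).
have Y0 : 0 <= Y by apply: integral_ge0 => x _; exact: poweR_ge0.
have step : \int[pi]_x `|(EFin \o truncate (fun x => u x ^+ 2)%R k) x| `^ s <=
    c%:E `^ (2 * s) * Y.
  rewrite -ge0_integralZl//; last 2 first.
    by move=> x _; exact: poweR_ge0.
    exact: poweR_ge0.
  apply: ge0_le_integral => //.
  - by move=> x _; exact: poweR_ge0.
  - apply: (measurableT_comp (measurable_poweR _)).
    apply: measurableT_comp; first exact: abse_measurable.
    apply/measurable_EFinP; apply: measurable_minr; last exact: measurable_cst.
    exact: measurable_funX.
  - exact: measurable_funeM.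
  - move=> x _; rewrite -poweRM ?abse_ge0 ?lee_fin//.
    rewrite E1E (_ : `|(mean_dist rho pi x)%:E| = (mean_dist rho pi x)%:E);
      last by rewrite gee0_abs// lee_fin.
    rewrite -EFinM poweRrM.
    apply: le_poweR; [exact: ltW|exact: abse_ge0|].
    rewrite poweR_EFin lee_fin powR_mulrn ?mulr_ge0//.
    have /andP[t0 _] :=
      @truncate_bound T R (fun x => u x ^+ 2)%R k x (fun x => sqr_ge0 _).
    rewrite ger0_norm// (le_trans (truncate_le _ _ _))//.
    by rewrite -real_normK ?num_real// lerXn2r ?nnegrE ?mulr_ge0.
rewrite LnormE (le_trans (le_poweR _ _ step))//.
- by rewrite invr_ge0 ltW.
- by apply: integral_ge0 => x _; exact: poweR_ge0.
rewrite poweRM ?poweR_ge0// -poweRrM mulfK ?gt_eqF// /eps LnormE -/Y.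
rewrite expe2 muleACA -EFinM poweR_EFin powR_mulrn// expr2.
rewrite lee_wpmul2l ?lee_fin ?mulr_ge0//.
have -> : (s^-1 = (2 * s)^-1 * 2)%R by rewrite invfM mulrC mulrA mulfV ?mul1r.
rewrite poweRrM (_ : 2 = 1 + 1)%R// poweRD; last first.
  by apply: add_neq0_poweRD_def; rewrite gt_eqF.
by rewrite !poweRe1// poweR_ge0.
Qed.

End lipschitz_moments.

(** * The martingale of a solution of Poisson's equation *)

Lemma measurable_sgr (R : realType) : measurable_fun setT (@Num.sg R).
Proof.
apply: nondecreasing_measurable => // x y xy.
by case: (sgrP x); case: (sgrP y); lra.
Qed.

Section square_integrable.
Context d (Omega : measurableType d) (R : realType) (Pr : probability Omega R).
Implicit Types f g : Omega -> R.

Definition square_integrable f := measurable_fun setT f /\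
  Pr.-integrable setT (fun w => (f w ^+ 2)%:E).

Lemma square_integrable_le f g : measurable_fun setT f -> square_integrable g ->
  (forall w, f w ^+ 2 <= g w ^+ 2)%R -> square_integrable f.
Proof.
move=> mf [mg gi] fg; split=> //; apply: le_integrable gi => //.
  by apply/measurable_EFinP; exact: measurable_funX.
by move=> w _ /=; rewrite lee_fin !ger0_norm ?sqr_ge0.
Qed.

Lemma square_integrableD f g : square_integrable f -> square_integrable g ->
  square_integrable (fun w => f w + g w)%R.
Proof.
move=> [mf fi] [mg gi]; have mfg := measurable_funD mf mg.
split; first exact: mfg.
have bi := integrableD measurableT (integrableZl measurableT 2 fi)
  (integrableZl measurableT 2 gi).
apply: le_integrable bi => //.
  by apply/measurable_EFinP; exact: measurable_funX.
move=> w _ /=; rewrite lee_fin ger0_norm ?sqr_ge0//.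
rewrite ger0_norm; first by have := sqr_ge0 (f w - g w)%R; nra.
by rewrite addr_ge0// mulr_ge0 ?sqr_ge0.
Qed.

Lemma square_integrableN f : square_integrable f ->
  square_integrable (fun w => - f w)%R.
Proof.
move=> fi; apply: square_integrable_le (fi) _; last by move=> w; rewrite sqrrN.
by apply: measurableT_comp; [|exact: fi.1].
Qed.

Lemma square_integrable0 : square_integrable (cst 0%R).
Proof.
split; first exact: measurable_cst.
rewrite (_ : (fun _ => _) = cst 0); first exact: integrable0.
by apply/funext => w; rewrite /= expr0n.
Qed.

Lemma square_integrableM f g : square_integrable f -> square_integrable g ->
  Pr.-integrable setT (fun w => (f w * g w)%:E).
Proof.
move=> [mf fi] [mg gi].
apply: le_integrable (integrableD measurableT fi gi) => //.
  by apply/measurable_EFinP; exact: measurable_funM.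
move=> w _ /=; rewrite lee_fin (@ger0_norm _ (_ + _)%R) ?addr_ge0 ?sqr_ge0//.
rewrite normrM -(real_normK (num_real (f w))) -(real_normK (num_real (g w))).
by have := sqr_ge0 (`|f w| - `|g w|)%R; nra.
Qed.

Lemma square_integrableP f : measurable_fun setT f ->
  \int[Pr]_w (f w ^+ 2)%:E < +oo -> square_integrable f.
Proof.
move=> mf foo; split=> //; apply/integrableP; split.
  by apply/measurable_EFinP; exact: measurable_funX.
by under eq_integral do rewrite /= ger0_norm ?sqr_ge0//.
Qed.

End square_integrable.

Section martingale_part.
Context d (T : measurableType d) d' (Omega : measurableType d') (R : realType).
Context (Pr : probability Omega R) (X : nat -> {mfun Omega >-> T}).
Context (P : R.-pker T ~> T) (nu : probability T R).
Hypothesis X_chain : markov_chain Pr X P nu.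
Context (u : T -> R) (V : R).
Hypothesis mu : measurable_fun setT u.
Hypothesis Pu : forall x, (P x).-integrable setT (EFin \o u).
Hypothesis uV : forall n, \int[Pr]_w (u (X n.+1 w) ^+ 2)%:E <= V%:E.
Hypothesis Puoo : forall n, \int[Pr]_w (avg P u (X n.+1 w) ^+ 2)%:E < +oo.

Let mPu : measurable_fun setT (avg P u). Proof. exact: measurable_avg. Qed.

(** The part of u(X_{j+1}) that is not predicted from X_j. *)
Definition innovation j w : R := (u (X j.+1 w) - avg P u (X j w))%R.

Definition poisson_martingale n w : R := (\sum_(1 <= j < n.+1) innovation j w)%R.

Lemma martingaleS n w : poisson_martingale n.+1 w =
  (poisson_martingale n w + innovation n.+1 w)%R.
Proof. by rewrite /poisson_martingale big_nat_recr. Qed.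

Lemma martingale0 w : poisson_martingale 0 w = 0%R.
Proof. by rewrite /poisson_martingale big_geq. Qed.

Let sq_u n : square_integrable Pr (fun w => u (X n.+1 w)).
Proof.
apply: square_integrableP; first exact: measurableT_comp.
exact: le_lt_trans (uV n) (ltry _).
Qed.

Let sq_Pu n : square_integrable Pr (fun w => avg P u (X n.+1 w)).
Proof. by apply: square_integrableP => //; exact: measurableT_comp. Qed.

Lemma square_integrable_innovation n : square_integrable Pr (innovation n.+1).
Proof. by apply: square_integrableD; [|apply: square_integrableN]. Qed.

Lemma square_integrable_martingale n : square_integrable Pr (poisson_martingale n).
Proof.
elim: n => [|n IH].
  rewrite (_ : poisson_martingale 0 = cst 0%R); first exact: square_integrable0.
  by apply/funext => w; rewrite martingale0.
rewrite (_ : poisson_martingale n.+1 =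
    fun w => poisson_martingale n w + innovation n.+1 w)%R.
  by apply: square_integrableD => //; exact: square_integrable_innovation.
by apply/funext => w; rewrite martingaleS.
Qed.

Local Notation past n := (g_sigma_algebraType (history_generator X n)).

(** Given the past, u(X_{n+2}) has conditional mean Pu(X_{n+1}). *)
Lemma innovation_orthogonal n (H : past n.+1 -> R) :
  measurable_fun setT H -> square_integrable Pr (H : Omega -> R) ->
  \int[Pr]_w (H w * innovation n.+1 w)%:E = 0.
Proof.
move=> mH sH.
have [HPi HE] := one_step (X := X n.+1) (X' := X n.+2) (Pr := Pr) (K := P)
  (measurable_funP (X n.+1)) (measurable_funP (X n.+2))
  (@history_measurable _ _ _ _ X n.+1)
  (fun B A GB mA => X_chain.2 n.+1 isT B A GB mA) mH mu Pu
  (square_integrableM sH (sq_u n.+1)).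
rewrite /innovation; under eq_integral do rewrite mulrBr EFinB.
rewrite integralB_EFin//; first by rewrite HE subee// integrable_fin_num.
exact: square_integrableM sH (sq_u n.+1).
Qed.

Lemma measurable_martingale n m : (n <= m)%N ->
  measurable_fun (setT : set (past m.+1)) (poisson_martingale n).
Proof.
move=> nm; elim: n nm => [|n IH] nm.
  rewrite (_ : poisson_martingale 0 = cst 0%R); first exact: measurable_cst.
  by apply/funext => w; rewrite martingale0.
rewrite (_ : poisson_martingale n.+1 =
    fun w => poisson_martingale n w + innovation n.+1 w)%R.
  apply: measurable_funD; first by apply: IH; exact: ltnW.
  apply: measurable_funB.
  - by apply: (measurableT_comp mu); apply: measurable_history.
  - by apply: (measurableT_comp mPu); apply: measurable_history; rewrite /= ltnW.
by apply/funext => w; rewrite martingaleS.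
Qed.

Lemma measurable_running_martingale n m : (n <= m)%N ->
  measurable_fun (setT : set (past m.+1))
    (fun w => running_max (poisson_martingale ^~ w) n).
Proof.
move=> nm; apply: (@measurable_running_max R _ (past m.+1) poisson_martingale) => k kn.
by apply: measurable_martingale; exact: leq_trans kn nm.
Qed.

Lemma square_integrable_running_martingale n :
  square_integrable Pr (fun w => running_max (poisson_martingale ^~ w) n).
Proof.
have mO : measurable_fun (setT : set Omega)
    (fun w => running_max (poisson_martingale ^~ w) n).
  apply: (one_step_measurable (G := history_generator X n.+1)).
    exact: history_measurable.
  exact: measurable_running_martingale.
split=> //.
have si : Pr.-integrable setT
    (fun w => \sum_(0 <= k < n) (poisson_martingale k.+1 w ^+ 2)%:E).
  by apply: integrable_sum => // k _; exact: (square_integrable_martingale _).2.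
apply: le_integrable si => //.
  by apply/measurable_EFinP; exact: measurable_funX.
move=> w _; rewrite sumEFin /= lee_fin (ger0_norm (sqr_ge0 _)) ger0_norm.
  exact: sqr_running_max_le_sum.
by apply: sumr_ge0 => k _; exact: sqr_ge0.
Qed.

(** The innovation is the difference of u(X_{n+2}) and its projection
    Pu(X_{n+1}) on the past, hence its norm is at most that of u(X_{n+2}). *)
Lemma innovation_moment n : \int[Pr]_w (innovation n.+1 w ^+ 2)%:E <= V%:E.
Proof.
apply: le_trans (uV n.+1).
have mH : measurable_fun (setT : set (past n.+1)) (fun w => avg P u (X n.+1 w)).
  by apply: (measurableT_comp mPu); apply: measurable_history; rewrite /= leqnn.
have ort := innovation_orthogonal mH (sq_Pu n).
have sI := square_integrable_innovation n.
have pI := square_integrableM (sq_Pu n) sI.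
have pI2 := integrableZl measurableT 2 pI.
apply: (@le_trans _ _ (\int[Pr]_w ((u (X n.+2 w) ^+ 2)%:E
    - 2%:E * (avg P u (X n.+1 w) * innovation n.+1 w)%:E))).
  apply: le_integral => //.
  - exact: sI.2.
  - by apply: integrableB => //; exact: (sq_u n.+1).2.
  - move=> w _; rewrite -EFinM -EFinB lee_fin /innovation.
    by have := sqr_ge0 (avg P u (X n.+1 w)); nra.
rewrite integralB//; last exact: (sq_u n.+1).2.
by rewrite integralZl// ort mule0 sube0.
Qed.

Lemma martingale_moment n :
  \int[Pr]_w (poisson_martingale n w ^+ 2)%:E <= (n%:R * V)%:E.
Proof.
elim: n => [|n IH].
  by under eq_integral do rewrite martingale0 expr0n; rewrite integral0 mul0r.
have sM := square_integrable_martingale n.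
have sI := square_integrable_innovation n.
have ort := innovation_orthogonal (measurable_martingale (leqnn n)) sM.
have pI2 := integrableZl measurableT 2 (square_integrableM sM sI).
have -> : (fun w => (poisson_martingale n.+1 w ^+ 2)%:E) =
    (fun w => (poisson_martingale n w ^+ 2)%:E
      + (2%:E * (poisson_martingale n w * innovation n.+1 w)%:E
         + (innovation n.+1 w ^+ 2)%:E)).
  apply/funext => w; rewrite -EFinM -!EFinD martingaleS; congr (_%:E).
  by ring.
rewrite integralD//; last 2 first.
- exact: sM.2.
- by apply: integrableD => //; exact: sI.2.
rewrite integralD//; last exact: sI.2.
rewrite integralZl//; last exact: square_integrableM.
rewrite ort mule0 add0e -natr1 mulrDl mul1r EFinD leeD//.
exact: innovation_moment.
Qed.

(** Doob's maximal inequality in L^2, by integrating pathwise_doob: each term of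
    its sum is a square-integrable function of the past times an innovation. *)
Lemma running_martingale_moment n :
  \int[Pr]_w (running_max (poisson_martingale ^~ w) n ^+ 2)%:E <= (4 * n%:R * V)%:E.
Proof.
(* the coefficients in pathwise_doob, bounded by the running maximum *)
pose H i w :=
  (running_max (poisson_martingale ^~ w) i * Num.sg (poisson_martingale i w))%R.
have mH i : measurable_fun (setT : set (past i.+1)) (H i).
  apply: measurable_funM; first exact: measurable_running_martingale.
  by apply: measurableT_comp (measurable_martingale (leqnn i)); exact: measurable_sgr.
have sH i : square_integrable Pr (H i).
  apply: square_integrable_le (square_integrable_running_martingale i) _.
    by apply: one_step_measurable (mH i); exact: history_measurable.
  move=> w; rewrite exprMn ler_piMr ?sqr_ge0//.
  by rewrite sqr_sg; case: (_ != _); rewrite ?ler01.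
have sI := square_integrable_innovation.
have HI i := square_integrableM (sH i) (sI i).
have sumI : Pr.-integrable setT
    (fun w => \sum_(0 <= i < n) (H i w * innovation i.+1 w)%:E).
  by apply: integrable_sum => // i _; exact: HI.
have sum0 : \int[Pr]_w (\sum_(0 <= i < n) (H i w * innovation i.+1 w)%:E) = 0.
  by rewrite integral_sum// big1// => i _; rewrite innovation_orthogonal.
have M4 := integrableZl measurableT 4 (square_integrable_martingale n).2.
have S4 := integrableZl measurableT 4 sumI.
apply: (@le_trans _ _ (\int[Pr]_w (4%:E * (poisson_martingale n w ^+ 2)%:E
    - 4%:E * \sum_(0 <= i < n) (H i w * innovation i.+1 w)%:E))).
  apply: le_integral => //.
  - exact: (square_integrable_running_martingale n).2.
  - exact: integrableB.
  - move=> w _; rewrite sumEFin -!EFinM -EFinB lee_fin.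
    rewrite (le_trans (pathwise_doob n (martingale0 w)))// lerD2l lerN2.
    rewrite ler_pM2l// le_eqVlt; apply/orP; left; apply/eqP.
    by apply: eq_bigr => i _; rewrite martingaleS addrAC subrr add0r.
rewrite integralB// !integralZl//; last exact: (square_integrable_martingale n).2.
rewrite sum0 mule0 sube0 -mulrA EFinM lee_wpmul2l//.
exact: martingale_moment.
Qed.

Lemma poisson_decomposition n w :
  (\sum_(1 <= j < n.+1) (u (X j w) - avg P u (X j w)) =
   u (X 1%N w) - u (X n.+1 w) + poisson_martingale n w)%R.
Proof.
elim: n => [|n IH]; first by rewrite big_geq// subrr martingale0 addr0.
by rewrite big_nat_recr//= IH martingaleS /innovation; ring.
Qed.

End martingale_part.

(** * The moment bound *)

Section real_bounds.
Context (R : realType).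

Lemma lty_real_bound (x : \bar R) : x < +oo -> exists2 t : R, (0 <= t)%R & x <= t%:E.
Proof.
case: x => [r _|//|_]; last by exists 0%R => //; exact: leNye.
by exists (Num.max r 0)%R; [rewrite le_max lexx orbT|rewrite lee_fin le_max lexx].
Qed.

Lemma lt1_real_bound (x : \bar R) : x < 1 ->
  exists k : R, [/\ (0 <= k)%R, (k < 1)%R & x <= k%:E].
Proof.
case: x => [r r1|//|_]; last by exists 0%R; split => //; exact: leNye.
exists (Num.max r 0)%R; split; first by rewrite le_max lexx orbT.
  by rewrite gt_max ltr01 andbT; move: r1; rewrite lte_fin.
by rewrite lee_fin le_max lexx.
Qed.

End real_bounds.

Section first_moment.
Context dT (T : measurableType dT) (R : realType) (rho : T -> T -> R).
Hypothesis rho_metric : is_metric rho.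
Hypothesis m_rho : measurable_fun setT (fun p : T * T => rho p.1 p.2).
Context (pi : probability T R).

(** A finite L^p norm makes E_1 finite at one point, and by the triangle
    inequality at every point. *)
Lemma eps_integrable_dist (p : R) : (0 < p)%R -> eps rho pi p < +oo ->
  forall x, pi.-integrable setT (EFin \o rho x).
Proof.
move=> p0; rewrite /eps LnormE => /lty_poweRy; rewrite gt_eqF ?invr_gt0// => /(_ isT).
move=> /(@ge0_integral_lty_witness _ _ _ pi _ (fun x => poweR_ge0 _ _))[x0].
move=> /lty_poweRy; rewrite gt_eqF// => /(_ isT) x0oo x.
apply: (lip_integrable rho_metric (x0 := x0)).
- exact: probability_setT.
- exact: lip_space_dist.
- apply/integrableP; split; first by apply/measurable_EFinP; exact: measurable_dist.
  under eq_integral do rewrite /= ger0_norm ?(is_metric_ge0 rho_metric)//.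
  by apply: le_lt_trans x0oo; exact: lee_abs.
Qed.

End first_moment.

Lemma S_max_le d (T : measurableType d) d' (Omega : measurableType d')
    (R : realType) (rho : T -> T -> R) (pi : probability T R)
    (P : R.-pker T ~> T) (X : nat -> {mfun Omega >-> T}) (f : T -> R) n w :
  let u := poisson_solution rho pi P f in
  (forall x, u x - avg P u x = f x)%R ->
  (S_max X f n w <= R_max rho pi P X f n w +
    running_max (poisson_martingale X P u ^~ w) n)%R.
Proof.
move=> u uf.
apply: (ler_running_max (x := fun k => \sum_(1 <= j < k.+1) f (X j w))%R).
  apply: addr_ge0; last exact: running_max_ge0.
  exact: (running_max_ge0 (fun k => u (X 1%N w) - u (X k.+1 w)))%R.
move=> k kn; rewrite (_ : (\sum_(1 <= j < k.+1) f (X j w))%R =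
    (u (X 1%N w) - u (X k.+1 w) + poisson_martingale X P u k w)%R).
  rewrite (le_trans (ler_normD _ _))// lerD//.
    exact: (@running_max_ge _ (fun k => u (X 1%N w) - u (X k.+1 w))%R n k kn).
  exact: (@running_max_ge _ (poisson_martingale X P u ^~ w) n k kn).
by rewrite -poisson_decomposition; apply: eq_bigr => j _; rewrite uf.
Qed.

Local Open Scope charge_scope.

Theorem corollary4p9 (R : realType)
  (dT : measure_display) (T : polishType R dT)
  (nontrivial : exists x y : T, x <> y)
  (d : T -> T -> R) (d_metric : is_metric d)
  (d_lsc : lower_semicontinuous (fun p : T * T => (d p.1 p.2)%:E))
  (P : R.-pker T ~> T) (P_contractive : wasserstein_contractive d P)
  (pi : probability T R) (pi_invariant : unique_invariant P pi)
  (nu : probability T R) (nu_pi : nu `<< pi)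
  (dOmega : measure_display) (Omega : measurableType dOmega)
  (Pr : probability Omega R) (X : nat -> {mfun Omega >-> T})
  (X_chain : markov_chain Pr X P nu)
  (q s r : R) (q_gt1 : (1 < q)%R) (s_gt1 : (1 < s)%R)
  (qs_conjugate : (q^-1 + s^-1 = 1)%R)
  (density_Lq : 'N[pi]_q%:E['d (charge_of_finite_measure nu) '/d pi] < +oo)
  (rE : r = (2 * s)%R) (eps_fin : eps d pi r < +oo)
  (C : R) (C_gt0 : (0 < C)%R)
  (R_max_bound : forall g : T -> R, lip_space0 d pi g ->
     forall n : nat, (0 < n)%N ->
     'E_Pr[fun w => (R_max d pi P X g n w ^+ 2)%R]
       <= (C * n%:R)%:E * lip_norm d g ^+ 2) :
  forall n : nat, (0 < n)%N ->
  ereal_sup [set 'E_Pr[fun w => (S_max X f n w ^+ 2)%R] |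
             f in [set f : T -> R | lip_space0 d pi f /\ lip_norm d f <= 1]]
  <= (4 * n%:R)%:E *
     (8%:E * 'N[pi]_q%:E['d (charge_of_finite_measure nu) '/d pi]
      * (Lambda d P * eps d pi r) ^+ 2 + C%:E).
Proof.
move=> n n_gt0; apply: ge_ereal_sup => _ [f [fL0 f1] <-].
have s_gt0 : (0 < s)%R by rewrite (lt_trans _ s_gt1).
have q_gt0 : (0 < q)%R by rewrite (lt_trans _ q_gt1).
have r_gt0 : (0 < r)%R by rewrite rE mulr_gt0.
have m_d : measurable_fun setT (fun p : T * T => d p.1 p.2).
  by apply/measurable_EFinP; exact: polish_lower_semicontinuous_measurable.
have pi_inv := pi_invariant.1.
have [tauoo [m m_gt0 taum1]] := P_contractive.
have [t t_ge0 tau_t] := lty_real_bound tauoo.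
have [k [k_ge0 k_lt1 taum_k]] := lt1_real_bound taum1.
have pi_dist := eps_integrable_dist d_metric m_d r_gt0 eps_fin.
have P_dist := invariant_integrable_dist d_metric m_d tau_t pi_dist pi_inv.
have lipP := lip_integrable_kernel d_metric P_dist.
have lip1 := (lip_norm_leP d_metric 1%R f).1 f1.
pose u := poisson_solution d pi P f.
have [uL0 uE] : lip_space0 d pi u /\ forall x, (u x - avg P u x = f x)%R.
  have [u' [u'L u'E]] := poisson_exists d_metric m_d t_ge0 tau_t pi_dist pi_inv
    m_gt0 k_ge0 k_lt1 taum_k fL0.
  have [] : lip_space0 d pi u /\ poisson_equation P f u.
    apply: (@xgetPex _ (cst 0%R)
      [set v | lip_space0 d pi v /\ poisson_equation P f v]).
    exists u'; split=> // x.
    by rewrite -EFin_avg ?(lipP _ u'L.1)// -EFinB u'E.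
  move=> uL uP; split=> // x.
  by have := uP x; rewrite -EFin_avg ?(lipP _ uL.1)// -EFinB => -[].
have [fL f0] := fL0; have [uL u0] := uL0.
have [c [c_ge0 uc c_Lambda]] := poisson_lip_bound d_metric m_d t_ge0 tau_t pi_dist
  pi_inv m_gt0 k_ge0 k_lt1 taum_k nontrivial fL lip1 uL uE.
have [mu _] := uL.
pose D := 'N[pi]_q%:E['d (charge_of_finite_measure nu) '/d pi].
have D_ge0 : 0 <= D by exact: Lnorm_ge0.
have eps_ge0 : 0 <= eps d pi r by exact: Lnorm_ge0.
(* for u the constant c yields the bound sought; for Pu finiteness suffices *)
have moment v (c' : R) : lip_space0 d pi v -> (0 <= c')%R -> lip_bound d c' v ->
    forall j, \int[Pr]_w (v (X j.+1 w) ^+ 2)%:E <= D * (c'%:E * eps d pi r) ^+ 2.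
  move=> [vL v0] c'0 vc j; have [mv _] := vL.
  apply: (chain_moment X_chain pi_inv nu_pi q_gt0 s_gt0 qs_conjugate j
    (f := fun x => v x ^+ 2)%R).
  - exact: measurable_funX.
  - by move=> x; exact: sqr_ge0.
  - move=> i; rewrite rE; apply: Lnorm_truncate_sqr => // x.
    exact: (mean_zero_le d_metric).
have finite_moment (c' : R) : D * (c'%:E * eps d pi r) ^+ 2 < +oo.
  rewrite lte_mul_pinfty// ?ge0_fin_numE//.
  have : c'%:E * eps d pi r \is a fin_num by rewrite fin_numM// ge0_fin_numE.
  by move=> h; rewrite -ge0_fin_numE ?sqre_ge0// expe2 fin_numM.
pose V := fine (D * (c%:E * eps d pi r) ^+ 2).
have V_ge0 : (0 <= V)%R by rewrite fine_ge0// mule_ge0// sqre_ge0.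
have VE : V%:E = D * (c%:E * eps d pi r) ^+ 2.
  by rewrite fineK// ge0_fin_numE// mule_ge0// sqre_ge0.
have uV j : \int[Pr]_w (u (X j.+1 w) ^+ 2)%:E <= V%:E.
  by rewrite VE; exact: moment.
have PuL : lip_space d (avg P u).
  exact: (lip_space_avg d_metric m_d t_ge0 tau_t P_dist).
have Puoo j : \int[Pr]_w (avg P u (X j.+1 w) ^+ 2)%:E < +oo.
  have [_ [c' c'0 c'P]] := (lip_spaceP d_metric _).1 PuL.
  apply: le_lt_trans (moment _ c' _ c'0 c'P j) (finite_moment c').
  by split=> //; rewrite (integral_pi_avg d_metric m_d tau_t pi_dist pi_inv).
pose M w := running_max (poisson_martingale X P u ^~ w) n.
have sM : square_integrable Pr M.
  exact: square_integrable_running_martingale mu (lipP _ uL) uV Puoo n.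
have EM := running_martingale_moment X_chain mu (lipP _ uL) uV Puoo n.
pose Rm w := R_max d pi P X f n w.
have mR : measurable_fun setT Rm.
  apply: (measurable_running_max (y := fun k w => u (X 1%N w) - u (X k.+1 w))%R).
  by move=> i _; apply: measurable_funB; exact: measurableT_comp.
have mS : measurable_fun setT (fun w => S_max X f n w).
  apply: (measurable_running_max (y := fun k w => \sum_(1 <= j < k.+1) f (X j w))%R).
  by move=> i _; apply: measurable_sum => j; apply: measurableT_comp => //; exact: fL.1.
have ER : \int[Pr]_w (Rm w ^+ 2)%:E <= (C * n%:R)%:E.
  have := R_max_bound f fL0 n n_gt0; rewrite unlock => /le_trans; apply.
  rewrite -[leRHS]mule1 lee_wpmul2l ?lee_fin ?mulr_ge0 ?(ltW C_gt0)//.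
  have l0 := lip_norm_ge0 d_metric f nontrivial.
  by rewrite expe2 -[leRHS]mule1 lee_pmul.
rewrite unlock.
apply: (@le_trans _ _ (\int[Pr]_w (2%:E * (Rm w ^+ 2)%:E + 2%:E * (M w ^+ 2)%:E))).
  apply: ge0_le_integral => //.
  - by move=> w _; rewrite lee_fin sqr_ge0.
  - by apply/measurable_EFinP; exact: measurable_funX.
  - apply: emeasurable_funD; apply: measurable_funeM; apply/measurable_EFinP;
      apply: measurable_funX => //; exact: sM.1.
  - move=> w _; rewrite -!EFinM -EFinD lee_fin.
    have S0 : (0 <= S_max X f n w)%R.
      exact: (running_max_ge0 (fun k => \sum_(1 <= j < k.+1) f (X j w)))%R.
    have SRM : (S_max X f n w <= Rm w + M w)%R by exact: S_max_le.
    have := sqr_ge0 (Rm w - M w)%R.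
    have : (S_max X f n w ^+ 2 <= (Rm w + M w) ^+ 2)%R.
      by rewrite lerXn2r ?nnegrE// (le_trans S0).
    by nra.
have mR2 : measurable_fun setT (fun w => (Rm w ^+ 2)%:E).
  by apply/measurable_EFinP; exact: measurable_funX.
have mM2 : measurable_fun setT (fun w => (M w ^+ 2)%:E).
  by apply/measurable_EFinP; apply: measurable_funX sM.1.
have sq0 (g : Omega -> R) w : [set: Omega] w -> 0 <= (g w ^+ 2)%:E.
  by move=> _; rewrite lee_fin sqr_ge0.
rewrite ge0_integralD//; last 4 first.
- by move=> w ?; rewrite mule_ge0// sq0.
- exact: measurable_funeM.
- by move=> w ?; rewrite mule_ge0// sq0.
- exact: measurable_funeM.
rewrite (ge0_integralZl Pr measurableT mR2)//; last exact: sq0.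
rewrite (ge0_integralZl Pr measurableT mM2)//; last exact: sq0.
(* 2 C n + 8 n V <= 4 n (8 V + C), with V the bound in which c replaces Lambda *)
apply: (@le_trans _ _ ((4 * n%:R)%:E * (8%:E * V%:E + C%:E))).
  apply: (@le_trans _ _ (2%:E * (C * n%:R)%:E + 2%:E * (4 * n%:R * V)%:E)).
    by rewrite leeD// lee_wpmul2l.
  rewrite -[leLHS]/(2 * (C * n%:R) + 2 * (4 * n%:R * V))%:E.
  rewrite -[leRHS]/(4 * n%:R * (8 * V + C))%:E lee_fin.
  have nV : (0 <= n%:R * V)%R by rewrite mulr_ge0.
  have nC : (0 <= n%:R * C)%R by rewrite mulr_ge0// ltW.
  nra.
rewrite lee_wpmul2l ?lee_fin ?mulr_ge0// leeD2r// VE -muleA.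
rewrite lee_wpmul2l// lee_wpmul2l// !expe2.
by rewrite lee_pmul ?mule_ge0// ?lee_wpmul2r.
Qed.
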